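(* (Midpoint loop cut.) Let $\mathcal G$ be a compact finite metric graph with Dirichlet vertex set $\mathsf V_{\mathrm D}$ satisfying the standing assumption of the context, and let $e\in\mathsf E$ be a loop (both endpoints of $e$ correspond to the same vertex). Let $\widetilde{\mathcal G}$ be the metric graph that arises from $\mathcal G$ by cutting $e$ through its midpoint (the point corresponding to $\ell_e/2$) into two pendant edges, both of length $\ell_e/2$ (the two new vertices of degree 1 being non-Dirichlet vertices, so that the Dirichlet set of $\widetilde{\mathcal G}$ is again $\mathsf V_{\mathrm D}$). Then $$\mathcal Q_t(\mathcal G;\mathsf V_{\mathrm D})=\mathcal Q_t(\widetilde{\mathcal G};\mathsf V_{\mathrm D})\qquad\text{for all }t>0.$$
   Context: Metric graph: $\mathcal G$ is obtained from a finite set $\mathsf E$ of edges, each $e\in\mathsf E$ identified with an interval $[0,\ell_e]$, $0<\ell_e<\infty$, by gluing endpoints at a finite set $\mathsf V$ of vertices (loops and multiple edges allowed). $\deg(v)$ is the number of edge ends at $v$ (a loop counts twice). Standing assumption: $\mathcal G$ has no vertices of degree 2 (they are removed by merging the two incident edges); $\emptyset\ne\mathsf V_{\mathrm D}\subset\{v\in\mathsf V:\deg(v)=1\}$; $\mathcal G\setminus\mathsf V_{\mathrm D}$ is connected. $\mathsf V_{\mathrm N}=\mathsf V\setminus\mathsf V_{\mathrm D}$. Heat content: $\Delta^{\mathcal G;\mathsf V_{\mathrm D}}$ is the Laplacian on $L^2(\mathcal G)=\bigoplus_e L^2(0,\ell_e)$ with Dirichlet conditions on $\mathsf V_{\mathrm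 D}$ and continuity and Kirchhoff conditions on $\mathsf V_{\mathrm N}$ (so Neumann conditions at non-Dirichlet vertices of degree 1), i.e. $-\Delta^{\mathcal G;\mathsf V_{\mathrm D}}$ is the self-adjoint operator associated with the form $a(u)=\int_{\mathcal G}|u'|^2\,dx$ on $H^1_0(\mathcal G;\mathsf V_{\mathrm D})=\{u\in\bigoplus_e H^1(0,\ell_e): u$ continuous at every vertex, $u(v)=0$ for $v\in\mathsf V_{\mathrm D}\}$. $p_t^{\mathcal G;\mathsf V_{\mathrm D}}(x,y)$ is the integral kernel of $e^{t\Delta^{\mathcal G;\mathsf V_{\mathrm D}}}$ and $\mathcal Q_t(\mathcal G;\mathsf V_{\mathrm D})=\int_{\mathcal G}\int_{\mathcal G}p_t^{\mathcal G;\mathsf V_{\mathrm D}}(x,y)\,dx\,dy$, $t>0$. *)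

(* Defs.v *)
From HB Require Import structures.
From mathcomp Require Import all_boot all_order all_algebra.
From mathcomp Require Import all_classical all_reals all_analysis.
Import Order.TTheory GRing.Theory Num.Theory.
Import numFieldNormedType.Exports.

Set Implicit Arguments.
Unset Strict Implicit.
Unset Printing Implicit Defensive.

Local Open Scope classical_set_scope.
Local Open Scope ring_scope.

(* Edge e is the interval [0, len e]; [ends e false] is the vertex to which the
   endpoint 0 is glued, [ends e true] the one to which len e is glued. *)
Record metric_graph (R : realType) : Type := MetricGraph {
  vertex : finType;
  edge : finType;
  len : edge -> R;
  len_gt0 : forall e : edge, 0 < len e;
  ends : edge -> bool -> vertex
}.

Arguments vertex {R} _.
Arguments edge {R} _.
Arguments len {R} _ _.
Arguments ends {R} _ _ _.

Section Combinatorics.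
Variables (R : realType) (G : metric_graph R).

Definition degree (v : vertex G) : nat :=
  #|[set a : edge G * bool | ends G a.1 a.2 == v]%SET|.

Definition is_loop (e : edge G) : bool := ends G e false == ends G e true.

(* The space G \ D is the disjoint union of the open edges and of the vertices
   not in D; an open edge is adjacent to the retained vertices among its ends. *)
Definition cell_adj (D : {set vertex G}) : rel (edge G + vertex G) :=
  fun c1 c2 => match c1, c2 with
  | inl e, inr v | inr v, inl e => (v \notin D) && [exists b, ends G e b == v]
  | _, _ => false
  end.

Definition is_cell (D : {set vertex G}) (c : edge G + vertex G) : bool :=
  if c is inr v then v \notin D else true.

Definition connected_off (D : {set vertex G}) : Prop :=
  forall c1 c2, is_cell D c1 -> is_cell D c2 -> connect (cell_adj D) c1 c2.

Definition standing_assumption (D : {set vertex G}) : Prop :=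
  [/\ forall v : vertex G, degree v <> 2%N,
      D <> finset.set0,
      forall v : vertex G, v \in D -> degree v = 1%N &
      connected_off D].

End Combinatorics.

Section Analysis.
Variables (R : realType) (G : metric_graph R).
Local Notation mu := (@lebesgue_measure R).

(* Only the values at 0 <= x <= len e are meaningful. *)
Definition graph_fun : Type := edge G -> R -> R.

Definition edge_itv (e : edge G) : set R := `[0, len G e].

Definition edge_point (e : edge G) (b : bool) : R := if b then len G e else 0.

Definition graph_int (f : graph_fun) : R :=
  \sum_(e : edge G) \int[mu]_(x in edge_itv e) f e x.

Definition L2 (f : graph_fun) : Prop :=
  forall e : edge G, measurable_fun (edge_itv e) (f e) /\
    mu.-integrable (edge_itv e) (fun x => (f e x ^+ 2)%:E).

Definition L2eq (f g : graph_fun) : Prop :=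
  forall e : edge G, {ae mu, forall x, edge_itv e x -> f e x = g e x}.

Definition L2inner (f g : graph_fun) : R :=
  graph_int (fun e x => f e x * g e x).

Definition L2norm (f : graph_fun) : R := Num.sqrt (L2inner f f).

(* u is (the absolutely continuous representative of) an element of the direct
   sum of the H^1(0, len e), and w is its derivative. *)
Definition H1 (u w : graph_fun) : Prop :=
  L2 w /\ forall (e : edge G) (x : R), edge_itv e x ->
    u e x = u e 0 + \int[mu]_(y in `[0, x]) w e y.

Definition H10 (D : {set vertex G}) (u w : graph_fun) : Prop :=
  [/\ H1 u w,
      forall e b e' b', ends G e b = ends G e' b' ->
        u e (edge_point e b) = u e' (edge_point e' b') &
      forall e b, ends G e b \in D -> u e (edge_point e b) = 0].

(* f lies in the domain of the Laplacian and g is its image: -g represents the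
   functional v |-> a(f, v) on the form domain, a(f, v) being the integral of
   f' v'. *)
Definition laplacian (D : {set vertex G}) (f g : graph_fun) : Prop :=
  [/\ L2 f, L2 g &
      exists u w : graph_fun, [/\ L2eq u f, H10 D u w &
        forall v z : graph_fun, H10 D v z ->
          L2inner w z = L2inner (fun e x => - g e x) v]].

(* Strongly continuous semigroups on L^2(G), elements of L^2(G) being given by
   representatives. *)
Definition C0_semigroup (T : R -> graph_fun -> graph_fun) : Prop :=
  [/\ (forall t, 0 <= t ->
         [/\ forall f, L2 f -> L2 (T t f),
             forall a f g, L2 f -> L2 g ->
               L2eq (T t (fun e x => a * f e x + g e x))
                    (fun e x => a * T t f e x + T t g e x) &
             exists C : R, forall f, L2 f -> L2norm (T t f) <= C * L2norm f]),
      (forall f, L2 f -> L2eq (T 0 f) f),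
      (forall s t f, 0 <= s -> 0 <= t -> L2 f ->
         L2eq (T (s + t) f) (T s (T t f))) &
      (forall f, L2 f ->
         L2norm (fun e x => T t f e x - f e x) @[t --> 0^'+] --> (0 : R))].

Definition generator (T : R -> graph_fun -> graph_fun) (f g : graph_fun)
    : Prop :=
  [/\ L2 f, L2 g &
      L2norm (fun e x => t^-1 * (T t f e x - f e x) - g e x) @[t --> 0^'+]
        --> (0 : R)].

Definition heat_semigroup (D : {set vertex G})
    (T : R -> graph_fun -> graph_fun) : Prop :=
  C0_semigroup T /\ forall f g, generator T f g <-> laplacian D f g.

Definition graph_kernel : Type := edge G -> R -> edge G -> R -> R.

Definition integral_kernel (S : graph_fun -> graph_fun) (k : graph_kernel)
    : Prop :=
  (forall e e', measurable_fun (edge_itv e `*` edge_itv e')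
     (fun xy : R * R => k e xy.1 e' xy.2)) /\
  forall f, L2 f -> forall e, {ae mu, forall x, edge_itv e x ->
    (forall e', mu.-integrable (edge_itv e')
       (fun y => (k e x e' y * f e' y)%:E)) /\
    S f e x = graph_int (fun e' y => k e x e' y * f e' y)}.

Definition heat_kernel (D : {set vertex G}) (p : R -> graph_kernel) : Prop :=
  exists T : R -> graph_fun -> graph_fun,
    heat_semigroup D T /\ forall t, 0 < t -> integral_kernel (T t) (p t).

Definition heat_content (p : R -> graph_kernel) (t : R) : R :=
  graph_int (fun e x => graph_int (fun e' y => p t e x e' y)).

End Analysis.

Section MidpointCut.
Variables (R : realType) (G : metric_graph R) (e : edge G).

(* [Some e] is the half [0, len e / 2] of e and [None] the half
   [len e / 2, len e], translated to start at 0; [inr false] and [inr true] are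
   the two copies of the midpoint. *)
Definition cut_len (i : option (edge G)) : R :=
  match i with
  | Some e' => if e' == e then len G e / 2 else len G e'
  | None => len G e / 2
  end.

Definition cut_ends (i : option (edge G)) (b : bool) : vertex G + bool :=
  match i with
  | Some e' => if (e' == e) && b then inr false else inl (ends G e' b)
  | None => if b then inl (ends G e true) else inr true
  end.

Lemma cut_len_gt0 i : 0 < cut_len i.
Proof.
by case: i => [e'|] /=; [case: ifP => _|]; rewrite ?divr_gt0 ?len_gt0.
Qed.

Definition midpoint_cut : metric_graph R :=
  @MetricGraph R (vertex G + bool)%type (option (edge G))
    cut_len cut_len_gt0 cut_ends.

Definition cut_dirichlet (D : {set vertex G}) : {set vertex midpoint_cut} :=
  [set inl v | v in D]%SET.

End MidpointCut.

(* Main.v *)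
Require Import Defs.
From mathcomp Require Import all_boot all_order all_algebra.
From mathcomp Require Import all_classical all_reals all_analysis.
From mathcomp Require Import measurable_realfun.
From mathcomp Require Import ring lra zify.
Import Order.TTheory GRing.Theory Num.Theory.
Import numFieldNormedType.Exports.

Set Implicit Arguments.
Unset Strict Implicit.
Unset Printing Implicit Defensive.

Local Open Scope classical_set_scope.
Local Open Scope ring_scope.

(** Let e be the loop, l its length, and let S send a function f on the graph G
    to its average (f + f') / 2, where f' is f composed with the reflection
    x |-> l - x of e, read on the two halves of e as a function on the cut graph
    G'. The heat content is the integral of T(t) 1, where T is the heat
    semigroup ([kernel_graph_int]). Since S fixes the constant 1 and preserves
    integrals ([graph_int_cut_avg]), it suffices that S T(t) 1 = T'(t) 1, where
    T' is the heat semigroup of G'.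

    This follows from S mapping the domain of the Laplacian of G into that of
    G' and commuting with the Laplacians ([cut_avg_laplacian]). In weak form
    the claim is a'(S u, v) = a(u, S* v), where the adjoint S* of S averages v
    over the two pendant edges and extends the result symmetrically to e. Both
    S and S* preserve the form domains: at the vertex of e they average equal
    values, because e is a loop; the two new vertices carry a single edge end
    each and impose nothing on S u; and S* v is continuous at the midpoint of e
    by symmetry.
    Differentiation exchanges even and odd functions, so the derivatives are
    transformed by the same operators with a minus sign; this is the parameter
    s of [cut_avg] and [unfold_avg].

    To pass from generators to semigroups ([intertwined_closure]), let f lie in
    the domain and put u(t) = S T(t) f - T'(t) S f. Then u(0) = 0, and u has
    the right derivative A' u(t), A' being the generator of T'. So |u|^2 has
    the right derivative 2 <u, A' u> <= 0, and it vanishes identically if it is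
    also continuous from the left. Left continuity of the orbits requires a
    bound on the operators T(s) that is uniform for s near a given time;
    pointwise bounds yield one by Baire's theorem ([orbit_interval_bound]).

    The constant 1 violates the Dirichlet condition, hence is not in the domain
    of the Laplacian, but it is the limit in L2 of functions of the domain that
    are given on each edge by a polynomial vanishing to second order at both
    ends ([laplacian_dense_at_one]). *)

(** * Growth along right derivatives *)

Lemma cvg0_rightP (R : realType) (f : R -> R) :
  (f t @[t --> 0^'+] --> (0 : R)) <->
  (forall eps : R, 0 < eps -> exists2 d : R, 0 < d &
     forall h, 0 < h -> h < d -> `|f h| < eps).
Proof.
split.
  move=> /cvgrPdist_lt fc eps eps0.
  have [d /= d0 Hd] := fc _ eps0.
  exists d => // h h0 hd.
  by have := Hd h; rewrite /= !sub0r !normrN gtr0_norm//; apply.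
move=> H; apply/cvgrPdist_lt => eps eps0.
have [d d0 Hd] := H _ eps0.
exists d => //= h /=; rewrite !sub0r !normrN => hd h0; apply: Hd => //.
by rewrite gtr0_norm in hd.
Qed.

(** For every eps, the times up to which phi r <= phi 0 + eps * r form an
    interval from 0. The first hypothesis keeps phi from jumping up at the
    supremum of that interval, and the second one extends the interval beyond
    it. *)
Lemma right_growth_le (R : realType) (phi : R -> R) :
  (forall t : R, 0 < t -> forall eps : R, 0 < eps -> exists2 d : R, 0 < d &
     forall h, 0 < h -> h < d -> h <= t -> phi t <= phi (t - h) + eps) ->
  (forall t : R, 0 <= t -> forall eps : R, 0 < eps -> exists2 d : R, 0 < d &
     forall h, 0 < h -> h < d -> phi (t + h) <= phi t + eps * h) ->
  forall t : R, 0 <= t -> phi t <= phi 0.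
Proof.
move=> lft rgt t t0; apply/ler_addgt0Pr => eps eps0.
pose e1 := eps / (t + 1).
have t10 : 0 < t + 1 by rewrite ltr_wpDl.
have e10 : 0 < e1 by rewrite divr_gt0.
suff H : phi t <= phi 0 + e1 * t.
  apply: (le_trans H); rewrite lerD2l /e1 -mulrA ler_piMr ?(ltW eps0)//.
  by rewrite ler_pdivrMl// mulr1 lerDl.
pose S := [set s | 0 <= s <= t /\ forall r, 0 <= r <= s -> phi r <= phi 0 + e1 * r].
have S0 : S 0.
  split; first by rewrite lexx.
  by move=> r; rewrite -eq_le => /eqP <-; rewrite mulr0 addr0.
have Sub : ubound S t by move=> s [/andP[]].
have hS : has_sup S by split; [exists 0 | exists t].
pose s := sup S.
have s0 : 0 <= s by apply: ub_le_sup => //; exists t.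
have st : s <= t by apply: ge_sup => //; exists 0.
have below r : 0 <= r -> r < s -> phi r <= phi 0 + e1 * r.
  move=> r0 rs; have [x Sx rx] := sup_gt (hS.1) rs.
  by case: Sx => _; apply; rewrite r0 ltW.
have ats : phi s <= phi 0 + e1 * s.
  have [->|sn0] := eqVneq s 0; first by rewrite mulr0 addr0.
  have sp : 0 < s by rewrite lt_def sn0.
  apply/ler_addgt0Pr => e2 e20.
  have [d d0 Hd] := lft _ sp _ e20.
  pose h := Num.min (d / 2) (s / 2).
  have h0 : 0 < h by rewrite lt_min !divr_gt0.
  have hd : h < d by rewrite gt_min ltr_pdivrMr// ltr_pMr// ltr1n.
  have hs : h < s by rewrite gt_min orbC ltr_pdivrMr// ltr_pMr// ltr1n.
  apply: (le_trans (Hd _ h0 hd (ltW hs))); rewrite lerD2r.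
  apply: le_trans (below _ _ _) _; rewrite ?subr_ge0 ?(ltW hs)//.
    by rewrite ltrBlDr ltrDl.
  by rewrite lerD2l ler_pM2l// lerBlDr lerDl ltW.
have below' r : 0 <= r -> r <= s -> phi r <= phi 0 + e1 * r.
  by move=> r0; rewrite le_eqVlt => /predU1P[->//|]; exact: below.
have [ts|sn] := eqVneq t s; first by rewrite ts; exact: ats.
have {sn} sltt : s < t by rewrite lt_def sn.
have [d d0 Hd] := rgt _ s0 _ e10.
pose h := Num.min (d / 2) (t - s).
have h0 : 0 < h by rewrite lt_min divr_gt0//= subr_gt0.
have hd : h < d by rewrite gt_min ltr_pdivrMr// ltr_pMr// ltr1n.
suff : S (s + h).
  move=> Sh; have : s + h <= s by apply: ub_le_sup => //; exists t.
  by rewrite gerDl leNgt h0.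
split; first by rewrite addr_ge0 ?(ltW h0)//= -lerBrDl ge_min lexx orbT.
move=> r /andP[r0 rsh]; have [rs|sr] := leP r s; first exact: below'.
have -> : r = s + (r - s) by rewrite addrC subrK.
apply: (le_trans (Hd _ _ _)); first by rewrite subr_gt0.
  by apply: le_lt_trans hd; rewrite lerBlDl.
have -> : phi 0 + e1 * (s + (r - s)) = phi 0 + e1 * s + e1 * (r - s).
  by rewrite (mulrDr e1 s) addrA.
by rewrite lerD2r.
Qed.

(** * Semi-inner product spaces *)

(** Elements of an L2 space are given here by representatives: the form is only
    semi-definite, and it is well behaved only on the square integrable
    functions, which form the subset [dom] of the ambient function space. *)
Record prehilbert (R : realType) (V : lmodType R) := PreHilbert {
  dom : V -> Prop;
  ip : V -> V -> R;
  dom0 : dom 0;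
  dom_lin : forall (a : R) f g, dom f -> dom g -> dom (a *: f + g);
  ipC : forall f g, ip f g = ip g f;
  ip_lin : forall (a : R) f g h, dom f -> dom g -> dom h ->
    ip (a *: f + g) h = a * ip f h + ip g h;
  ip_ge0 : forall f, 0 <= ip f f }.

Section PrehilbertTheory.
Context {R : realType} {V : lmodType R} (X : prehilbert V).
Implicit Types (f g h : V) (a : R).

Definition nrm f : R := Num.sqrt (ip X f f).

Lemma domD f g : dom X f -> dom X g -> dom X (f + g).
Proof. by move=> df dg; rewrite -[f]scale1r; exact: dom_lin. Qed.

Lemma domZ a f : dom X f -> dom X (a *: f).
Proof. by move=> df; rewrite -[_ *: _]addr0; apply: dom_lin => //; exact: dom0. Qed.

Lemma domB f g : dom X f -> dom X g -> dom X (f - g).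
Proof. by move=> df dg; apply: domD => //; rewrite -scaleN1r; exact: domZ. Qed.

Lemma ipDl f g h : dom X f -> dom X g -> dom X h ->
  ip X (f + g) h = ip X f h + ip X g h.
Proof. by move=> df dg dh; rewrite -{1}[f]scale1r ip_lin// mul1r. Qed.

Lemma ipDr f g h : dom X f -> dom X g -> dom X h ->
  ip X h (f + g) = ip X h f + ip X h g.
Proof. by move=> df dg dh; rewrite !(ipC X h) ipDl. Qed.

Lemma ip0l f : dom X f -> ip X 0 f = 0.
Proof.
move=> df; have := ipDl (dom0 X) (dom0 X) df; rewrite addr0.
by move/eqP; rewrite -subr_eq subrr eq_sym => /eqP.
Qed.

Lemma ipZl a f g : dom X f -> dom X g -> ip X (a *: f) g = a * ip X f g.
Proof.
move=> df dg; rewrite -[_ *: _]addr0 ip_lin ?ip0l ?addr0//; exact: dom0.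
Qed.

Lemma ipZr a f g : dom X f -> dom X g -> ip X f (a *: g) = a * ip X f g.
Proof. by move=> df dg; rewrite ipC ipZl// ipC. Qed.

Lemma nrm_ge0 f : 0 <= nrm f. Proof. exact: sqrtr_ge0. Qed.

Lemma sqr_nrm f : nrm f ^+ 2 = ip X f f.
Proof. by rewrite sqr_sqrtr// ip_ge0. Qed.

Lemma nrm0 : nrm 0 = 0.
Proof. by rewrite /nrm ip0l ?sqrtr0//; exact: dom0. Qed.

Lemma cauchy_schwarz f g : dom X f -> dom X g -> ip X f g <= nrm f * nrm g.
Proof.
move=> df dg; have [fg0|fg0] := leP (ip X f g) 0.
  by apply: (le_trans fg0); rewrite mulr_ge0 ?nrm_ge0.
rewrite -(ler_pXn2r (ltn0Sn 1)) ?nnegrE ?mulr_ge0 ?nrm_ge0 ?(ltW fg0)//.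
rewrite exprMn !sqr_nrm.
have key (a b : R) : 0 <= a ^+ 2 * ip X f f + 2 * a * b * ip X f g + b ^+ 2 * ip X g g.
  have := ip_ge0 X (a *: f + b *: g).
  rewrite !(ipDl, ipDr, ipZl, ipZr); try by [|apply: domZ|apply: domD; apply: domZ].
  rewrite (ipC X g f) => /le_trans; apply.
  by rewrite le_eqVlt; apply/orP; left; apply/eqP; ring.
(* If g is null, its coefficient in [key] may be arbitrarily large. *)
have [g0|g0] := eqVneq (ip X g g) 0.
  have := key (ip X f g) (- (ip X f f + 1)).
  rewrite g0 !mulr0 addr0.
  have := ip_ge0 X f; move: fg0; nra.
have {g0} gg : 0 < ip X g g by rewrite lt_def g0 ip_ge0.
have := key (ip X g g) (- ip X f g).
have -> : ip X g g ^+ 2 * ip X f f + 2 * ip X g g * - ip X f g * ip X f g +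
    (- ip X f g) ^+ 2 * ip X g g = ip X g g * (ip X f f * ip X g g - ip X f g ^+ 2) by ring.
by rewrite pmulr_rge0// subr_ge0.
Qed.

Lemma nrmD f g : dom X f -> dom X g -> nrm (f + g) <= nrm f + nrm g.
Proof.
move=> df dg; rewrite -(ler_pXn2r (ltn0Sn 1)) ?nnegrE ?addr_ge0 ?nrm_ge0//.
rewrite sqrrD !sqr_nrm !(ipDl, ipDr)//; last exact: domD.
rewrite (ipC X g f).
have := cauchy_schwarz df dg; lra.
Qed.

Lemma nrmZ a f : dom X f -> nrm (a *: f) = `|a| * nrm f.
Proof.
move=> df; rewrite /nrm ipZl ?ipZr//; last exact: domZ.
by rewrite mulrA -expr2 sqrtrM ?sqr_ge0// sqrtr_sqr.
Qed.

Lemma nrmN f : dom X f -> nrm (- f) = nrm f.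
Proof. by move=> df; rewrite -scaleN1r nrmZ// normrN normr1 mul1r. Qed.

Lemma nrmB f g : dom X f -> dom X g -> nrm (f - g) <= nrm f + nrm g.
Proof.
move=> df dg; rewrite -(nrmN dg) -scaleN1r; apply: nrmD => //; exact: domZ.
Qed.

Lemma nrm_distC f g : dom X f -> dom X g -> nrm (f - g) = nrm (g - f).
Proof. by move=> df dg; rewrite -opprB nrmN//; exact: domB. Qed.

Lemma nrm_tri h f g : dom X f -> dom X g -> dom X h ->
  nrm (f - g) <= nrm (f - h) + nrm (h - g).
Proof.
move=> df dg dh; rewrite -{1}(subrKA h f); apply: nrmD; exact: domB.
Qed.

Lemma nrm_le_dist f g : dom X f -> dom X g -> nrm f <= nrm (f - g) + nrm g.
Proof.
move=> df dg; rewrite -{1}(subrK g f); apply: nrmD => //; exact: domB.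
Qed.

Lemma sqr_nrm_lin a f g : dom X f -> dom X g ->
  nrm (f + a *: g) ^+ 2 = nrm f ^+ 2 + 2 * (a * ip X f g) + a ^+ 2 * nrm g ^+ 2.
Proof.
move=> df dg; have dag := domZ a dg.
rewrite !sqr_nrm !(ipDl, ipDr) ?(ipZl, ipZr) ?(ipC X g f)//; last exact: domD.
ring.
Qed.

(** Equality in the associated Hausdorff space. *)
Definition eqv f g := [/\ dom X f, dom X g & nrm (f - g) = 0].

Lemma eqv_refl f : dom X f -> eqv f f.
Proof. by move=> df; split; rewrite // subrr nrm0. Qed.

Lemma eqv_sym f g : eqv f g -> eqv g f.
Proof. by case=> df dg fg; split; rewrite // nrm_distC. Qed.

Lemma eqv_trans f g h : eqv f g -> eqv g h -> eqv f h.
Proof.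
move=> [df dg fg] [_ dh gh]; split => //; apply/eqP; rewrite eq_le nrm_ge0 andbT.
by apply: le_trans (nrm_tri df dh dg) _; rewrite fg gh addr0.
Qed.

Lemma eqv_lin a f f' g g' : eqv f f' -> eqv g g' -> eqv (a *: f + g) (a *: f' + g').
Proof.
move=> [df df' ff] [dg dg' gg]; split; [exact: dom_lin..|].
apply/eqP; rewrite eq_le nrm_ge0 andbT opprD addrACA -scalerBr.
apply: le_trans (nrmD _ _) _; [by apply: domZ; apply: domB|exact: domB|].
by rewrite gg nrmZ ?ff ?mulr0 ?addr0//; apply: domB.
Qed.

Lemma eqvB f f' g g' : eqv f f' -> eqv g g' -> eqv (f - g) (f' - g').
Proof.
by move=> ff gg; rewrite addrC [f' - _]addrC -(scaleN1r g) -(scaleN1r g'); apply: eqv_lin.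
Qed.

Lemma eqvZ a f f' : eqv f f' -> eqv (a *: f) (a *: f').
Proof.
move=> ff; rewrite -[a *: f]addr0 -[a *: f']addr0; apply: eqv_lin => //.
exact: eqv_refl (dom0 X).
Qed.

Lemma nrm_eqv f g : eqv f g -> nrm f = nrm g.
Proof.
move=> [df dg fg]; apply/eqP; rewrite eq_le; apply/andP; split.
  by apply: le_trans (nrm_le_dist df dg) _; rewrite fg add0r.
by apply: le_trans (nrm_le_dist dg df) _; rewrite nrm_distC// fg add0r.
Qed.

End PrehilbertTheory.

(** * Strongly continuous semigroups *)

Section Semigroups.
Context {R : realType} {V : lmodType R} (X : prehilbert V).
Variable T : R -> V -> V.
Implicit Types (f g : V) (s t eps : R).

(** Boundedness is required at each fixed time only; bounds that are uniform in
    time are a consequence, see [orbit_left_bound]. *)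
Definition c0_semigroup : Prop :=
  [/\ (forall t, 0 <= t ->
         [/\ forall f, dom X f -> dom X (T t f),
             forall a f g, dom X f -> dom X g ->
               nrm X (T t (a *: f + g) - (a *: T t f + T t g)) = 0 &
             exists C : R, forall f, dom X f -> nrm X (T t f) <= C * nrm X f]),
      (forall f, dom X f -> nrm X (T 0 f - f) = 0),
      (forall s t f, 0 <= s -> 0 <= t -> dom X f ->
         nrm X (T (s + t) f - T s (T t f)) = 0) &
      (forall f, dom X f -> nrm X (T t f - f) @[t --> 0^'+] --> (0 : R))].

Definition generator_of (f g : V) : Prop :=
  [/\ dom X f, dom X g &
      nrm X (t^-1 *: (T t f - f) - g) @[t --> 0^'+] --> (0 : R)].

Hypothesis semT : c0_semigroup.

Lemma orbit_dom t f : 0 <= t -> dom X f -> dom X (T t f).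
Proof. by case: semT => H _ _ _ t0; have [h _ _] := H _ t0; exact: h. Qed.

Lemma orbit_lin t a f g : 0 <= t -> dom X f -> dom X g ->
  eqv X (T t (a *: f + g)) (a *: T t f + T t g).
Proof.
case: semT => H _ _ _ t0 df dg; have [hd hl _] := H _ t0.
by split; [exact/hd/dom_lin|apply: dom_lin; exact: hd|exact: hl].
Qed.

Lemma orbit_sub t f g : 0 <= t -> dom X f -> dom X g ->
  eqv X (T t (f - g)) (T t f - T t g).
Proof.
by move=> t0 df dg; have := orbit_lin (-1) t0 dg df; rewrite !scaleN1r !(addrC (- _)).
Qed.

Lemma orbit_scale t a f : 0 <= t -> dom X f -> eqv X (T t (a *: f)) (a *: T t f).
Proof.
move=> t0 df; have d0 := dom0 X.
have -> : a *: f = a *: f + (f - f) by rewrite subrr addr0.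
apply: eqv_trans (orbit_lin a t0 df (domB df df)) _.
have dT : dom X (T t f) by exact: orbit_dom.
rewrite -[X in eqv _ _ X]addr0 -(subrr (T t f)).
by apply: eqv_lin; [exact: eqv_refl|exact: orbit_sub].
Qed.

Lemma orbit_bound t : 0 <= t -> exists2 C, 0 < C &
  forall f, dom X f -> nrm X (T t f) <= C * nrm X f.
Proof.
case: semT => H _ _ _ t0; have [hd hl [C hC]] := H _ t0.
exists (Num.max C 1); first by rewrite lt_max ltr01 orbT.
move=> f df.
apply: (le_trans (hC _ df)); rewrite ler_wpM2r ?nrm_ge0//.
by rewrite le_max lexx.
Qed.

Lemma orbit_lipschitz t : 0 <= t -> exists2 C, 0 < C &
  forall f g, dom X f -> dom X g -> nrm X (T t f - T t g) <= C * nrm X (f - g).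
Proof.
move=> t0; have [C C0 HC] := orbit_bound t0; exists C => // f g df dg.
by rewrite -(nrm_eqv (orbit_sub t0 df dg)); apply: HC; exact: domB.
Qed.

Lemma orbit_semigroup s t f : 0 <= s -> 0 <= t -> dom X f ->
  eqv X (T (s + t) f) (T s (T t f)).
Proof.
move=> s0 t0 df; split; [|by do 2 apply: orbit_dom => //|].
  by apply: orbit_dom => //; exact: addr_ge0.
by case: semT => _ _ H _; exact: H.
Qed.

Lemma orbit0 f : dom X f -> eqv X (T 0 f) f.
Proof. by move=> df; split => //; [exact: orbit_dom|case: semT => _ H _ _; exact: H]. Qed.

Lemma orbit_right_continuous f t eps : dom X f -> 0 <= t -> 0 < eps ->
  exists2 d : R, 0 < d & forall h, 0 < h -> h < d ->
    nrm X (T (t + h) f - T t f) < eps.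
Proof.
move=> df t0 eps0; have [C C0 HC] := orbit_lipschitz t0.
have [_ _ _ /(_ f df)/cvg0_rightP] := semT.
move=> /(_ (eps / C))[|d d0 Hd]; first by rewrite divr_gt0.
exists d => // h h0 hd.
have dTh : dom X (T h f) by apply: orbit_dom => //; exact: ltW.
rewrite (nrm_eqv (eqvB (orbit_semigroup t0 (ltW h0) df) (eqv_refl (orbit_dom t0 df)))).
apply: le_lt_trans (HC _ _ dTh df) _.
by have := Hd _ h0 hd; rewrite ger0_norm ?nrm_ge0// ltr_pdivlMr// mulrC.
Qed.

(** Suppose that on no interval all T s are bounded by the same n. Right
    continuity of the orbits makes the set [B n] of the times at which the
    bound n fails contain a right neighbourhood of each of its points, so the
    interior of [B n] is dense. By Baire's theorem some time in (0, a) lies in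
    all [B n]; but the operator at that time is bounded. *)
Lemma orbit_interval_bound (a : R) : 0 < a -> exists (n : nat) (c d : R),
  [/\ 0 <= c, c < d, d <= a &
    forall s f, c < s -> s < d -> dom X f -> nrm X (T s f) <= n%:R * nrm X f].
Proof.
move=> a0; apply: contrapT => Hn.
(* All times outside [0, a] belong to [B n], which leaves only open sets within
   [0, a] to consider for density. *)
pose B (n : nat) : set R := [set s | 0 <= s <= a ->
  exists2 f, dom X f & n%:R * nrm X f < nrm X (T s f)].
have /Baire /(_ `]0, a[%classic) : forall n, open ((B n)° : set R^o) /\ dense ((B n)° : set R^o).
  move=> n; split; first exact: open_interior.
  move=> O [x Ox] oO.
  have /nbhs_ballP[e /= e0 xeO] : nbhs x O by exact: open_nbhs_nbhs.
  have [[y [xey yN]]|allin] := pselect (exists y, ball x e y /\ ~ (0 <= y <= a)).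
    exists y; split; first exact: xeO.
    have oN : open (~` `[0, a]%classic : set R) by apply: closed_openC; exact: itv_closed.
    have /nbhs_ballP[r /= r0 yr] : nbhs y (~` `[0, a]%classic : set R).
      by apply: open_nbhs_nbhs; split => //=; rewrite in_itv.
    apply/nbhs_ballP; exists r => //= z /yr /=.
    by rewrite in_itv/= => zN zI; exfalso; apply: zN.
  have inI y : x - e < y -> y < x + e -> 0 <= y <= a.
    move=> ye1 ye2; apply: contrapT => yN; apply: allin; exists y; split => //.
    by rewrite /ball/= ltr_norml; apply/andP; split; lra.
  have [s [s1 s2 [f df sf]]] : exists s, [/\ x - e / 2 < s, s < x + e / 2 &
      exists2 f, dom X f & n%:R * nrm X f < nrm X (T s f)].
    apply: contrapT => Hs; apply: Hn; exists n, (x - e / 2), (x + e / 2); split.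
    - by have /andP[] : 0 <= x - e / 2 <= a by apply: inI; lra.
    - lra.
    - by have /andP[] : 0 <= x + e / 2 <= a by apply: inI; lra.
    - move=> s f s1 s2 df; rewrite leNgt; apply/negP => nf; apply: Hs.
      by exists s; split => //; exists f.
  have /andP[s0 sa] : 0 <= s <= a by apply: inI; lra.
  have [d d0 Hd] : exists2 d, 0 < d & forall h, 0 < h -> h < d ->
      nrm X (T (s + h) f - T s f) < nrm X (T s f) - n%:R * nrm X f.
    by apply: orbit_right_continuous => //; rewrite subr_gt0.
  pose m := Num.min d (e / 2).
  have m0 : 0 < m by rewrite lt_min d0 divr_gt0.
  have md : m <= d by rewrite ge_min lexx.
  have me : m <= e / 2 by rewrite ge_min lexx orbT.
  exists (s + m / 2); split.
    by apply: xeO; rewrite /ball/= ltr_norml; apply/andP; split; lra.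
  apply/nbhs_ballP; exists (m / 2) => /=; first by rewrite divr_gt0.
  move=> z; rewrite /ball/= ltr_norml => /andP[z1 z2] _.
  exists f => //.
  have -> : z = s + (z - s) by rewrite addrC subrK.
  have h0 : 0 < z - s by lra.
  have hd : z - s < d by lra.
  have := Hd _ h0 hd.
  have zz : 0 <= s + (z - s) by lra.
  have := nrm_le_dist (orbit_dom s0 df) (orbit_dom zz df).
  rewrite nrm_distC; [|exact: orbit_dom|exact: orbit_dom]; lra.
case.
- by exists (a / 2); rewrite /= in_itv/=; apply/andP; split; lra.
- exact: interval_open.
move=> s [/=]; rewrite in_itv/= => /andP[s0 sa] Hs.
have [C C0 HC] := orbit_bound (ltW s0).
have [n Cn] : exists n : nat, C <= n%:R.
  by exists (Num.truncn C).+1; apply/ltW/truncnS_gt.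
have /interior_subset/= [|f df] := Hs n I; first by rewrite !ltW.
rewrite ltNge => /negP; apply.
by apply: (le_trans (HC _ df)); rewrite ler_wpM2r ?nrm_ge0.
Qed.

(** With s0 in the interval of uniform boundedness, T (t - h) is the fixed
    operator T (t - s0) after T (s0 - h), whose time stays in that interval. *)
Lemma orbit_left_bound t : 0 < t -> exists C d : R, [/\ 0 < C, 0 < d &
  forall h f, 0 < h -> h < d -> h <= t -> dom X f ->
    nrm X (T (t - h) f) <= C * nrm X f].
Proof.
move=> t0; have [n [c [d [c0 cd dt Hn]]]] := orbit_interval_bound t0.
pose s0 := (c + d) / 2.
have ts0 : 0 <= t - s0 by rewrite /s0; lra.
have [C C0 HC] := orbit_bound ts0.
exists (C * n.+1%:R), ((d - c) / 2); split; first by rewrite mulr_gt0.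
  by rewrite divr_gt0// subr_gt0.
move=> h f h0 hd ht df.
have s1 : c < s0 - h by rewrite /s0; lra.
have s2 : s0 - h < d by rewrite /s0; lra.
have s3 : 0 <= s0 - h by lra.
have -> : t - h = (t - s0) + (s0 - h) by ring.
rewrite (nrm_eqv (orbit_semigroup ts0 s3 df)).
apply: le_trans (HC _ (orbit_dom s3 df)) _; rewrite -mulrA ler_pM2l//.
apply: le_trans (Hn _ _ s1 s2 df) _.
by rewrite ler_wpM2r ?nrm_ge0// ler_nat.
Qed.

(** T (t - h) f - T t f is T (t - h) applied to f - T h f, which tends to 0. *)
Lemma orbit_left_continuous f t eps : dom X f -> 0 < t -> 0 < eps ->
  exists2 d : R, 0 < d & forall h, 0 < h -> h < d -> h <= t ->
    nrm X (T (t - h) f - T t f) < eps.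
Proof.
move=> df t0 eps0.
have [C [d [C0 d0 HC]]] := orbit_left_bound t0.
have [_ _ _ /(_ f df)/cvg0_rightP] := semT.
move=> /(_ (eps / C))[|d' d'0 Hd']; first by rewrite divr_gt0.
exists (Num.min d d'); first by rewrite lt_min d0.
move=> h h0; rewrite lt_min => /andP[hd hd'] ht.
have th0 : 0 <= t - h by rewrite subr_ge0.
have dTh : dom X (T h f) by apply: orbit_dom => //; exact: ltW.
have dd : dom X (f - T h f) by exact: domB.
have e1 : eqv X (T t f) (T (t - h) (T h f)).
  by rewrite -{1}(subrK h t); apply: orbit_semigroup => //; exact: ltW.
rewrite (nrm_eqv (eqvB (eqv_refl (orbit_dom th0 df)) e1)).
rewrite -(nrm_eqv (orbit_sub th0 df dTh)).
apply: le_lt_trans (HC _ _ h0 hd ht dd) _.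
rewrite nrm_distC//.
by have := Hd' _ h0 hd'; rewrite ger0_norm ?nrm_ge0// ltr_pdivlMr// mulrC.
Qed.

(** The difference quotients at 0 commute with the bounded operator T t. *)
Lemma generator_of_orbit t f g : 0 <= t -> generator_of f g ->
  generator_of (T t f) (T t g).
Proof.
move=> t0 [df dg /cvg0_rightP lim]; split; [exact: orbit_dom|exact: orbit_dom|].
apply/cvg0_rightP => eps eps0.
have [C C0 HC] := orbit_lipschitz t0.
have [|d d0 Hd] := lim (eps / C); first by rewrite divr_gt0.
exists d => // h h0 hd; have := Hd _ h0 hd.
rewrite !ger0_norm ?nrm_ge0// ltr_pdivlMr// mulrC.
apply: le_lt_trans.
have hp := ltW h0.
have dThf : dom X (T h f) by exact: orbit_dom.
have dA : dom X (h^-1 *: (T h f - f)) by apply: domZ; exact: domB.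
apply: le_trans (HC _ _ dA dg).
rewrite le_eqVlt; apply/orP; left; apply/eqP/nrm_eqv.
have dTtf : dom X (T t f) by exact: orbit_dom.
apply: eqvB; last by apply: eqv_refl; exact: orbit_dom.
apply: eqv_sym; apply: eqv_trans (orbit_scale h^-1 t0 (domB dThf df)) _.
apply: eqvZ; apply: eqv_trans (orbit_sub t0 dThf df) _.
apply: eqvB; last exact: eqv_refl.
apply: eqv_trans (eqv_sym (orbit_semigroup t0 hp df)) _.
by rewrite addrC; exact: orbit_semigroup.
Qed.

End Semigroups.

(** * Intertwining of semigroups *)

Lemma subACA (V : zmodType) (a b c d : V) : a - b - (c - d) = a - c - (b - d).
Proof. by rewrite !opprD !opprK addrACA. Qed.

Section Generator.
Context {R : realType} {V : lmodType R} (X : prehilbert V).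
Variable T : R -> V -> V.
Hypothesis semT : c0_semigroup X T.
Implicit Types (f g : V) (t eps : R).

Lemma generator_ofB f g f' g' : generator_of X T f g -> generator_of X T f' g' ->
  generator_of X T (f - f') (g - g').
Proof.
move=> [df dg /cvg0_rightP l1] [df' dg' /cvg0_rightP l2].
split; [exact: domB|exact: domB|apply/cvg0_rightP => eps eps0].
have e20 : 0 < eps / 2 by rewrite divr_gt0.
have [d1 d10 H1] := l1 _ e20; have [d2 d20 H2] := l2 _ e20.
exists (Num.min d1 d2); first by rewrite lt_min d10.
move=> h h0; rewrite lt_min => /andP[/(H1 _ h0) {}H1 /(H2 _ h0) {}H2].
move: H1 H2; rewrite !ger0_norm ?nrm_ge0// => H1 H2.
rewrite (splitr eps); apply: le_lt_trans (ltrD H1 H2).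
have hp := ltW h0.
have dT u : dom X u -> dom X (T h u) by exact: orbit_dom.
have dB u v : dom X u -> dom X v -> dom X (u - v) by exact: domB.
have dZ u : dom X u -> dom X (h^-1 *: u) by exact: domZ.
apply: le_trans (nrmB _ _); [|by auto|by auto].
rewrite le_eqVlt; apply/orP; left; apply/eqP/nrm_eqv.
have -> : h^-1 *: (T h f - f) - g - (h^-1 *: (T h f' - f') - g') =
  h^-1 *: ((T h f - T h f') - (f - f')) - (g - g').
  by rewrite [LHS]subACA -scalerBr (subACA (T h f)).
apply: eqvB; last by apply: eqv_refl; auto.
by apply: eqvZ; apply: eqvB; [exact: orbit_sub|apply: eqv_refl; auto].
Qed.

Lemma orbit_right_derivative f g t eps :
  0 <= t -> generator_of X T f g -> 0 < eps ->
  exists2 d : R, 0 < d & forall h, 0 < h -> h < d ->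
    nrm X (T (t + h) f - (T t f + h *: T t g)) <= eps * h.
Proof.
move=> t0 fg eps0; have [dTf dTg /cvg0_rightP lim] := generator_of_orbit semT t0 fg.
have [df dg _] := fg.
have [d d0 Hd] := lim _ eps0; exists d => // h h0 hd.
have hp := ltW h0.
have := Hd _ h0 hd; rewrite ger0_norm ?nrm_ge0// => /ltW H.
rewrite mulrC -ler_pdivrMl//.
apply: le_trans H; rewrite -{1}(gtr0_norm h0) -normfV -nrmZ; last first.
  apply: domB; first by apply: orbit_dom => //; exact: addr_ge0.
  by apply: domD => //; exact: domZ.
rewrite opprD addrA scalerBr scalerA mulVf ?gt_eqF// scale1r.
rewrite le_eqVlt; apply/orP; left; apply/eqP/nrm_eqv.
apply: eqvB; last exact: eqv_refl.
apply: eqvZ; apply: eqvB; last exact: eqv_refl.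
by rewrite addrC; exact: orbit_semigroup.
Qed.

End Generator.

Section Intertwining.
Context {R : realType} {V1 V2 : lmodType R}.
Variables (X1 : prehilbert V1) (X2 : prehilbert V2).
Variables (T1 : R -> V1 -> V1) (T2 : R -> V2 -> V2) (S : V1 -> V2).
Implicit Types (t eps : R).
Hypotheses (sem1 : c0_semigroup X1 T1) (sem2 : c0_semigroup X2 T2).
Hypothesis S_dom : forall f, dom X1 f -> dom X2 (S f).
Hypothesis S_lin : forall (a : R) f g, S (a *: f + g) = a *: S f + S g.
Variable K : R.
Hypothesis S_bound : forall f, dom X1 f -> nrm X2 (S f) <= K * nrm X1 f.
Hypothesis S_generator : forall f g, generator_of X1 T1 f g ->
  generator_of X2 T2 (S f) (S g).
Hypothesis dissip : forall f g, generator_of X2 T2 f g -> ip X2 f g <= 0.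

Let S_sub f g : S (f - g) = S f - S g.
Proof. by rewrite addrC -scaleN1r S_lin scaleN1r addrC. Qed.

Let S_add f g : S (f + g) = S f + S g.
Proof. by rewrite -{1}[f]scale1r S_lin scale1r. Qed.

Let S_scale a f : S (a *: f) = a *: S f.
Proof.
have S0 : S 0 = 0 by rewrite -(subrr 0) S_sub subrr.
by rewrite -[a *: f]addr0 S_lin S0 addr0.
Qed.

(* A positive bound for S, by which one can divide. *)
Let K' := Num.max K 1.
Let K'0 : 0 < K'. Proof. by rewrite lt_max ltr01 orbT. Qed.
Let S_bound' f : dom X1 f -> nrm X2 (S f) <= K' * nrm X1 f.
Proof.
move=> df; apply: le_trans (S_bound df) _.
by rewrite ler_wpM2r ?nrm_ge0// le_max lexx.
Qed.

Let u f t : V2 := S (T1 t f) - T2 t (S f).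

Let u_dom f t : 0 <= t -> dom X1 f -> dom X2 (u f t).
Proof.
move=> t0 df; apply: domB; first by apply: S_dom; exact: orbit_dom.
by apply: orbit_dom => //; exact: S_dom.
Qed.

Let u_left f t eps : dom X1 f -> 0 < t -> 0 < eps ->
  exists2 d : R, 0 < d & forall h, 0 < h -> h < d -> h <= t ->
    nrm X2 (u f t - u f (t - h)) < eps.
Proof.
move=> df t0 eps0.
have e1 : 0 < eps / 2 / K' by rewrite !divr_gt0.
have e2 : 0 < eps / 2 by rewrite divr_gt0.
have [d1 d10 H1] := orbit_left_continuous sem1 df t0 e1.
have [d2 d20 H2] := orbit_left_continuous sem2 (S_dom df) t0 e2.
exists (Num.min d1 d2); first by rewrite lt_min d10.
move=> h h0; rewrite lt_min => /andP[hd1 hd2] ht.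
have th : 0 <= t - h by rewrite subr_ge0.
have tt := ltW t0.
rewrite nrm_distC; [|exact: u_dom|exact: u_dom].
have -> : u f (t - h) - u f t =
   S (T1 (t - h) f - T1 t f) - (T2 (t - h) (S f) - T2 t (S f)).
  by rewrite S_sub subACA.
have dS := S_dom df.
have dA : dom X1 (T1 (t - h) f - T1 t f) by apply: domB; exact: orbit_dom.
apply: le_lt_trans (nrmB _ _) _; [exact: S_dom|by apply: domB; exact: orbit_dom|].
rewrite (splitr eps); apply: ltrD; last exact: H2.
apply: le_lt_trans (S_bound' dA) _.
by have := H1 _ h0 hd1 ht; rewrite ltr_pdivlMr// mulrC.
Qed.

Let u_right f g t eps : generator_of X1 T1 f g -> 0 <= t -> 0 < eps ->
  exists2 d : R, 0 < d & forall h, 0 < h -> h < d ->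
    nrm X2 (u f (t + h) - (u f t + h *: u g t)) <= eps * h.
Proof.
move=> fg t0 eps0; have [df dg _] := fg.
have e1 : 0 < eps / 2 / K' by rewrite !divr_gt0.
have e2 : 0 < eps / 2 by rewrite divr_gt0.
have [d1 d10 H1] := orbit_right_derivative sem1 t0 fg e1.
have [d2 d20 H2] := orbit_right_derivative sem2 t0 (S_generator fg) e2.
exists (Num.min d1 d2); first by rewrite lt_min d10.
move=> h h0; rewrite lt_min => /andP[hd1 hd2].
have th : 0 <= t + h by rewrite addr_ge0// ltW.
have -> : u f (t + h) - (u f t + h *: u g t) =
   S (T1 (t + h) f - (T1 t f + h *: T1 t g)) -
   (T2 (t + h) (S f) - (T2 t (S f) + h *: T2 t (S g))).
  by rewrite S_sub S_add S_scale [RHS]subACA /u scalerBr (addrACA (S (T1 t f))) -opprD.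
have dS := S_dom df.
have dA : dom X1 (T1 (t + h) f - (T1 t f + h *: T1 t g)).
  apply: domB; first exact: orbit_dom.
  by apply: domD; [exact: orbit_dom|apply: domZ; exact: orbit_dom].
apply: le_trans (nrmB _ _) _; [exact: S_dom| |].
  apply: domB; first exact: orbit_dom.
  by apply: domD; [exact: orbit_dom|apply: domZ; apply: orbit_dom => //; exact: S_dom].
rewrite (splitr eps) mulrDl; apply: lerD; last exact: H2.
apply: le_trans (S_bound' dA) _.
by have := H1 _ h0 hd1; rewrite mulrAC ler_pdivlMr// mulrC.
Qed.

(** The difference u of the two sides solves the evolution equation of T2 with
    initial value 0, and its squared norm phi is an energy, which cannot grow
    because the generator of T2 is dissipative. *)
Lemma intertwined_orbit f g t : generator_of X1 T1 f g -> 0 <= t ->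
  nrm X2 (S (T1 t f) - T2 t (S f)) = 0.
Proof.
move=> fg; have [df dg _] := fg.
move: t; pose phi t := nrm X2 (u f t) ^+ 2.
have phi0 : phi 0 = 0.
  rewrite /phi; suff -> : nrm X2 (u f 0) = 0 by rewrite expr0n.
  have e1 : eqv X2 (S (T1 0 f)) (S f).
    have d1 : dom X1 (T1 0 f) by exact: orbit_dom.
    split; [exact: S_dom|exact: S_dom|].
    apply/eqP; rewrite eq_le nrm_ge0 andbT -S_sub.
    apply: le_trans (S_bound' (domB d1 df)) _.
    by case: (orbit0 sem1 df) => _ _ ->; rewrite mulr0.
  have e2 := eqvB e1 (orbit0 sem2 (S_dom df)).
  by rewrite /u (nrm_eqv e2) subrr nrm0.
suff H : forall t, 0 <= t -> phi t <= phi 0.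
  move=> t t0; have := H t t0; rewrite phi0 /phi => H1.
  by apply/eqP; rewrite -sqrf_eq0 eq_le H1 sqr_ge0.
apply: right_growth_le => t t0 eps eps0.
- set U := nrm X2 (u f t).
  have U0 : 0 <= U by exact: nrm_ge0.
  have U1 : 0 < 2 * U + 1 by rewrite ltr_wpDl// mulr_ge0.
  have [d d0 Hd] := u_left df t0 (divr_gt0 eps0 U1).
  exists d => // h h0 hd ht; have := Hd _ h0 hd ht.
  rewrite ltr_pdivlMr// => H; rewrite /phi -/U.
  have th : 0 <= t - h by rewrite subr_ge0.
  have := nrm_le_dist (u_dom (ltW t0) df) (u_dom th df); rewrite -/U.
  set a := nrm X2 (_ - _) in H *.
  have := nrm_ge0 X2 (u f (t - h)); set W := nrm X2 (u f (t - h)).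
  have a0 : 0 <= a by exact: nrm_ge0.
  move=> W0 UW; rewrite !expr2.
  have [UW'|WU] := leP U W; first by nra.
  have : (U - W) * (U + W) <= a * (2 * U) by apply: ler_pM; lra.
  nra.
- set U := nrm X2 (u f t).
  have dug : dom X2 (u g t) by exact: u_dom.
  have duf : dom X2 (u f t) by exact: u_dom.
  set G := nrm X2 (u g t).
  have U0 : 0 <= U by exact: nrm_ge0.
  have G0 : 0 <= G by exact: nrm_ge0.
  (* With b the relative error of the linear expansion of u at t and c a bound
     on the step h, phi exceeds phi t by at most h * (b^2 h + 2 b A + h G^2),
     where A is the norm of the linear part; see p5. *)
  pose b := Num.min 1 (eps / (4 * (U + G + 1))).
  have UG : 0 < U + G + 1 by lra.
  have b0 : 0 < b by rewrite lt_min ltr01 divr_gt0// mulr_gt0.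
  have b1 : b <= 1 by rewrite ge_min lexx.
  have b2 : b * (U + G) <= eps / 4.
    have : b * (4 * (U + G + 1)) <= eps.
      by rewrite -ler_pdivlMr ?mulr_gt0// ge_min lexx orbT.
    by nra.
  pose c := Num.min 1 (eps / (4 * (G ^+ 2 + 1))).
  have GG : 0 < G ^+ 2 + 1 by rewrite ltr_wpDl// sqr_ge0.
  have c0 : 0 < c by rewrite lt_min ltr01 divr_gt0// mulr_gt0.
  have c1 : c <= 1 by rewrite ge_min lexx.
  have c2 : c * (G ^+ 2 + 1) <= eps / 4.
    have : c * (4 * (G ^+ 2 + 1)) <= eps.
      by rewrite -ler_pdivlMr ?mulr_gt0// ge_min lexx orbT.
    by nra.
  have [d d0 Hd] := u_right fg t0 b0.
  exists (Num.min d c); first by rewrite lt_min d0.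
  move=> h h0; rewrite lt_min => /andP[hd hc].
  have th : 0 <= t + h by rewrite addr_ge0// ltW.
  have dl : dom X2 (u f t + h *: u g t) by apply: domD => //; exact: domZ.
  have H := Hd _ h0 hd.
  have := nrm_le_dist (u_dom th df) dl.
  set A := nrm X2 (u f t + h *: u g t).
  set W := nrm X2 (u f (t + h)); set r := nrm X2 (_ - _) in H *.
  move=> WA.
  have A1 : A <= U + h * G.
    by apply: le_trans (nrmD _ _) _; rewrite ?nrmZ ?gtr0_norm//; exact: domZ.
  have A2 : A ^+ 2 <= U ^+ 2 + h ^+ 2 * G ^+ 2.
    rewrite sqr_nrm_lin//.
    have : ip X2 (u f t) (u g t) <= 0.
      apply: dissip; apply: generator_ofB => //.
        by apply: S_generator; exact: generator_of_orbit.
      by apply: generator_of_orbit => //; exact: S_generator.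
    rewrite -(pmulr_rle0 _ h0) -/U -/G; lra.
  have A0 : 0 <= A by exact: nrm_ge0.
  have W0 : 0 <= W by exact: nrm_ge0.
  have WA' : W <= b * h + A by apply: (le_trans WA); rewrite lerD2r.
  rewrite /phi -/U -/W.
  have : W ^+ 2 <= (b * h + A) ^+ 2.
    by rewrite ler_pXn2r// nnegrE addr_ge0// mulr_ge0// ltW.
  move=> /le_trans; apply.
  have h1 : h <= 1 by apply: le_trans c1; exact: ltW.
  have hG : h * G <= G by rewrite ler_piMl.
  have p1 : b * A <= eps / 4 by apply: le_trans b2; rewrite ler_pM2l//; lra.
  have p2 : h * (G ^+ 2 + 1) <= eps / 4.
    by apply: le_trans c2; rewrite ler_pM2r// ltW.
  have p3 : b ^+ 2 <= 1 by rewrite expr_le1// ltW.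
  have p4 : h * b ^+ 2 <= h by rewrite ler_piMr// ltW.
  have p5 : b ^+ 2 * h + 2 * (b * A) + h * G ^+ 2 <= eps by lra.
  have := ler_wpM2l (ltW h0) p5; lra.
Qed.

(** At a fixed time both sides are bounded in f, so the identity extends to the
    closure of the domain of the generator. *)
Lemma intertwined_closure f t : dom X1 f -> 0 <= t ->
  (forall eps, 0 < eps ->
    exists h g, generator_of X1 T1 h g /\ nrm X1 (f - h) < eps) ->
  nrm X2 (S (T1 t f) - T2 t (S f)) = 0.
Proof.
move=> df t0 H; apply/eqP; rewrite eq_le nrm_ge0 andbT.
have [C1 C10 HC1] := orbit_lipschitz sem1 t0; have [C2 C20 HC2] := orbit_lipschitz sem2 t0.
apply/ler_addgt0Pr => eps eps0; rewrite add0r.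
pose c := K' * C1 + C2 * K'.
have c0 : 0 < c by rewrite addr_gt0// mulr_gt0.
have [h [g [hg fh]]] := H _ (divr_gt0 eps0 c0).
have [dh _ _] := hg; have dfh := domB df dh.
move: fh; rewrite ltr_pdivlMr// => fh.
have dT1 v : dom X1 v -> dom X1 (T1 t v) by exact: orbit_dom.
have dT2 v : dom X2 v -> dom X2 (T2 t v) by exact: orbit_dom.
have /= e0 := intertwined_orbit hg t0.
have -> : nrm X2 (S (T1 t f) - T2 t (S f)) = nrm X2 ((S (T1 t f) - T2 t (S f)) - 0).
  by rewrite subr0.
apply: le_trans (nrm_tri (h := S (T1 t h) - T2 t (S h)) _ _ _) _;
  [by apply: domB; auto|exact: dom0|by apply: domB; auto|].
rewrite subr0 e0 addr0 subACA.
apply: le_trans (nrmB _ _) _; [by apply: domB; auto|by apply: domB; auto|].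
rewrite -S_sub.
apply: le_trans (lerD (S_bound' _) (HC2 _ _ _ _)) _; [by apply: domB; auto|by auto|by auto|].
rewrite -S_sub.
apply: le_trans (lerD (ler_wpM2l _ (HC1 _ _ _ _)) (ler_wpM2l _ (S_bound' dfh))) _ => //;
  try exact: ltW.
by move: fh; rewrite /c; lra.
Qed.

End Intertwining.

(** * Reflections of the line *)

Section Reflection.
Context {R : realType}.
Local Notation mu := (@lebesgue_measure R).
Implicit Types (a b c : R).

Lemma preimage_reflection c a b :
  (fun x => c - x) @^-1` `[a, b]%classic = `[c - b, c - a]%classic.
Proof. by apply/seteqP; split => x /=; rewrite !in_itv/= => /andP[? ?]; apply/andP; split; lra. Qed.

Lemma measurable_reflection c : measurable_fun [set: R] (fun x : R => c - x).
Proof. by apply: measurable_funB. Qed.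

(** The measure is determined by its values on half-open intervals. *)
Lemma lebesgue_measure_reflection c (A : set R) : measurable A ->
  pushforward mu (fun x => c - x : measurableTypeR R) A = mu A.
Proof.
move=> mA; apply/esym.
apply: (@lebesgue_measure_unique R (pushforward mu (fun x => c - x : measurableTypeR R))) => //=.
  exact: measurable_reflection.
move=> _ _ [[a b]] _ <-.
rewrite /pushforward.
have -> : (fun x => c - x) @^-1` `]a, b]%classic = `[c - b, c - a[%classic.
  by apply/seteqP; split => x /=; rewrite !in_itv/= => /andP[? ?]; apply/andP; split; lra.
rewrite !lebesgue_measure_itv/= !lte_fin.
have -> : (c - b < c - a) = (a < b) by apply/idP/idP; lra.
by case: ifP => // _; rewrite -!EFinB; congr (_%:E); ring.
Qed.

Lemma measurable_fun_reflection c a b (f : R -> R) :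
  measurable_fun `[a, b] f -> measurable_fun `[c - b, c - a] (fun x => f (c - x)).
Proof.
move=> mf; apply: (@measurable_comp _ _ _ _ _ _ `[a, b]%classic) => //.
- by rewrite -preimage_reflection; exact: image_preimage_subset.
- apply: measurable_funS (measurable_reflection c) => //.
Qed.

Local Open Scope ereal_scope.
Lemma ge0_integral_reflection c a b (f : R -> \bar R) :
  measurable_fun `[a, b] f -> (forall x, 0 <= f x) ->
  \int[mu]_(x in `[(c - b)%R, (c - a)%R]) f (c - x)%R = \int[mu]_(x in `[a, b]) f x.
Proof.
move=> mf f0.
rewrite -preimage_reflection.
rewrite -(@ge0_integral_pushforward _ _ (measurableTypeR R) (measurableTypeR R) R
  (fun x : measurableTypeR R => (c - x)%R : measurableTypeR R)
  (measurable_reflection c)) //.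
apply: eq_measure_integral; first exact: measurable_reflection.
by move=> mr A mA _; exact: lebesgue_measure_reflection.
Qed.

Lemma integral_reflection c a b (f : R -> \bar R) :
  measurable_fun `[a, b] f ->
  \int[mu]_(x in `[(c - b)%R, (c - a)%R]) f (c - x)%R = \int[mu]_(x in `[a, b]) f x.
Proof.
move=> mf; rewrite integralE [RHS]integralE.
congr (_ - _).
- rewrite -(ge0_integral_reflection c (measurable_funepos mf)).
    by apply: eq_integral => x _; rewrite -[LHS]/((f \o (fun y => c - y)%R)^\+ x) funepos_comp.
  by move=> x; exact: funepos_ge0.
- rewrite -(ge0_integral_reflection c (measurable_funeneg mf)).
    by apply: eq_integral => x _; rewrite -[LHS]/((f \o (fun y => c - y)%R)^\- x) funeneg_comp.
  by move=> x; exact: funeneg_ge0.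
Qed.

Lemma integrable_reflection c a b (f : R -> R) :
  mu.-integrable `[a, b] (EFin \o f) ->
  mu.-integrable `[(c - b)%R, (c - a)%R] (EFin \o (fun x => f (c - x)%R)).
Proof.
move=> /integrableP[mf fi]; apply/integrableP; split.
  by apply/measurable_EFinP; apply: measurable_fun_reflection; apply/measurable_EFinP.
have mabs : measurable_fun `[a, b] (fun x => `|(f x)%:E|) by exact: measurableT_comp.
have E := ge0_integral_reflection c mabs (fun x => abse_ge0 _).
by apply: le_lt_trans fi; rewrite le_eqVlt -E eqxx.
Qed.

Local Close Scope ereal_scope.
Lemma Rintegral_reflection c a b (f : R -> R) :
  measurable_fun `[a, b] f ->
  \int[mu]_(x in `[c - b, c - a]) f (c - x) = \int[mu]_(x in `[a, b]) f x.
Proof.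
move=> mf; congr fine.
have mE : measurable_fun `[a, b] (EFin \o f) by exact/measurable_EFinP.
exact: (integral_reflection c mE).
Qed.

End Reflection.

(** * Square integrable functions on an interval *)

Section SquareIntegrable.
Context {R : realType}.
Local Notation mu := (@lebesgue_measure R).
Implicit Types (a b c : R) (f g : R -> R).

Definition integrable_on a b f := mu.-integrable `[a, b] (EFin \o f).

Definition L2on a b f := measurable_fun `[a, b] f /\
  mu.-integrable `[a, b] (fun x => (f x ^+ 2)%:E).

Lemma integrable_on_le a b f g : measurable_fun `[a, b] f ->
  (forall x, `[a, b]%classic x -> `|f x| <= g x) -> integrable_on a b g -> integrable_on a b f.
Proof.
move=> mf fg ig; apply: le_integrable ig => //; first exact/measurable_EFinP.
move=> x abx /=; rewrite lee_fin; apply: le_trans (fg _ abx) _; exact: ler_norm.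
Qed.

Lemma integrable_onD a b f g : integrable_on a b f -> integrable_on a b g ->
  integrable_on a b (fun x => f x + g x).
Proof. by move=> fi gi; exact: (integrableD _ fi gi). Qed.

Lemma integrable_onZ a b c f : integrable_on a b f -> integrable_on a b (fun x => c * f x).
Proof. by move=> fi; exact: (integrableZl _ _ fi). Qed.

Lemma integrable_on_cst a b c : integrable_on a b (fun=> c).
Proof.
apply: measurable_bounded_integrable => //.
  by rewrite /= lebesgue_measure_itv/=; case: ifP; rewrite ?ltry// -EFinB ltry.
exists `|c|; split; first by rewrite num_real.
by move=> x cx y _; exact: ltW.
Qed.

Lemma integrable_on_sub a b a' b' f : a <= a' -> b' <= b ->
  integrable_on a b f -> integrable_on a' b' f.
Proof.
move=> aa bb; apply: integrableS => //.
move=> x /=; rewrite !in_itv/= => /andP[? ?]; apply/andP; split; lra.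
Qed.

Lemma integrable_on_eq a b f g : (forall x, `[a, b]%classic x -> f x = g x) ->
  integrable_on a b f -> integrable_on a b g.
Proof.
by move=> fg; apply: eq_integrable => // x; rewrite inE => /fg /= ->.
Qed.

Lemma eq_Rint a b f g : (forall x, `[a, b]%classic x -> f x = g x) ->
  \int[mu]_(x in `[a, b]) f x = \int[mu]_(x in `[a, b]) g x.
Proof. by move=> fg; apply: eq_Rintegral => x; rewrite inE => /fg. Qed.

Lemma L2on_mul a b f g : L2on a b f -> L2on a b g ->
  integrable_on a b (fun x => f x * g x).
Proof.
move=> [mf fi] [mg gi].
apply: (@integrable_on_le _ _ _ (fun x => f x ^+ 2 + g x ^+ 2)).
- exact: measurable_funM.
- move=> x _; rewrite normrM -[f x ^+ 2]real_normK ?num_real// -[g x ^+ 2]real_normK ?num_real//.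
  have := sqr_ge0 (`|f x| - `|g x|); have := normr_ge0 (f x); have := normr_ge0 (g x).
  nra.
- exact: integrable_onD.
Qed.

Lemma L2on_cst a b c : L2on a b (fun=> c).
Proof. by split; [|exact: integrable_on_cst]. Qed.

Lemma L2on_int a b f : L2on a b f -> integrable_on a b f.
Proof.
move=> f2; have := L2on_mul f2 (L2on_cst a b 1).
by apply: integrable_on_eq => x _; rewrite mulr1.
Qed.

Lemma L2on_lin a b c f g : L2on a b f -> L2on a b g ->
  L2on a b (fun x => c * f x + g x).
Proof.
move=> f2 g2; have [mf fi] := f2; have [mg gi] := g2; split.
  by apply: measurable_funD => //; apply: measurable_funM.
apply: (@integrable_on_eq _ _ (fun x => (c ^+ 2 * f x ^+ 2 + (2 * c) * (f x * g x)) + g x ^+ 2)).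
  by move=> x _; ring.
apply: integrable_onD => //; apply: integrable_onD; first exact: integrable_onZ.
by apply: integrable_onZ; exact: L2on_mul.
Qed.

Lemma L2on_eq a b f g : (forall x, `[a, b]%classic x -> f x = g x) ->
  L2on a b f -> L2on a b g.
Proof.
move=> fg [mf fi]; split.
  by apply: eq_measurable_fun mf => x; rewrite inE => /fg.
by apply: (integrable_on_eq (f := fun x => f x ^+ 2)) => // x /fg ->.
Qed.

Lemma L2on_scale a b c f : L2on a b f -> L2on a b (fun x => c * f x).
Proof.
move=> f2; apply: L2on_eq (L2on_lin c f2 (L2on_cst a b 0)) => x _.
by rewrite addr0.
Qed.

Lemma L2on_sub a b a' b' f : a <= a' -> b' <= b -> L2on a b f -> L2on a' b' f.
Proof.
move=> aa bb [mf fi]; split; last exact: (integrable_on_sub aa bb (f := fun x => f x ^+ 2)).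
apply: measurable_funS mf => //.
move=> x /=; rewrite !in_itv/= => /andP[? ?]; apply/andP; split; lra.
Qed.

Lemma L2on_bounded a b f M : measurable_fun `[a, b] f ->
  (forall x, `[a, b]%classic x -> `|f x| <= M) -> L2on a b f.
Proof.
move=> mf fM; split => //.
apply: (@integrable_on_le _ _ (fun x => f x ^+ 2) (fun=> M ^+ 2)); last exact: integrable_on_cst.
  exact: measurable_funX.
move=> x abx; rewrite normrX ler_pXn2r ?nnegrE//; first exact: fM.
by apply: le_trans (fM _ abx).
Qed.

Lemma L2on_continuous a b f : {within `[a, b], continuous f} -> L2on a b f.
Proof.
move=> cf.
have mf : measurable_fun `[a, b] f by apply: subspace_continuous_measurable_fun.
have /compact_bounded[M [_ mrt]] := continuous_compact cf (@segment_compact _ a b).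
apply: (@L2on_bounded _ _ _ (M + 1)) => // x abx.
by apply: (mrt (M + 1)) => //=; [rewrite ltrDl|exists x].
Qed.

Lemma L2on_reflection c a b a' b' f : a' = c - b -> b' = c - a -> L2on a b f ->
  L2on a' b' (fun x => f (c - x)).
Proof.
move=> -> -> [mf fi]; split; first exact: measurable_fun_reflection.
exact: (integrable_reflection c (f := fun x => f x ^+ 2)).
Qed.

Lemma integrable_on_reflection c a b a' b' f : a' = c - b -> b' = c - a -> integrable_on a b f ->
  integrable_on a' b' (fun x => f (c - x)).
Proof. by move=> -> -> fi; exact: (integrable_reflection c). Qed.

Lemma integrable_on_measurable a b f : integrable_on a b f -> measurable_fun `[a, b] f.
Proof. by move=> /integrableP[/measurable_EFinP]. Qed.

Lemma Rint_reflection c a b a' b' f : a' = c - b -> b' = c - a -> integrable_on a b f ->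
  \int[mu]_(x in `[a', b']) f (c - x) = \int[mu]_(x in `[a, b]) f x.
Proof.
by move=> -> -> /integrable_on_measurable fi; exact: Rintegral_reflection.
Qed.

Lemma Rint_split a m b f : a <= m -> m <= b -> integrable_on a b f ->
  \int[mu]_(x in `[a, b]) f x =
  \int[mu]_(x in `[a, m]) f x + \int[mu]_(x in `[m, b]) f x.
Proof.
move=> am mb fi; have := @Rintegral_itvB _ f (BLeft a) (BRight b) m fi.
rewrite !bnd_simp => /(_ am mb) H.
rewrite -(@Rintegral_itv_obnd_cbnd _ m (BRight b) f); first by rewrite -H addrC subrK.
apply: integrableS fi => // x /=; rewrite !in_itv/= => /andP[mx ->].
by rewrite (le_trans am) ?ltW.
Qed.

Lemma RintD a b f g : integrable_on a b f -> integrable_on a b g ->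
  \int[mu]_(x in `[a, b]) (f x + g x) =
  \int[mu]_(x in `[a, b]) f x + \int[mu]_(x in `[a, b]) g x.
Proof. by move=> fi gi; exact: RintegralD. Qed.

Lemma RintZ a b c f : integrable_on a b f ->
  \int[mu]_(x in `[a, b]) (c * f x) = c * \int[mu]_(x in `[a, b]) f x.
Proof. by move=> fi; exact: RintegralZl. Qed.

Lemma Rint_fold l f : 0 <= l -> integrable_on 0 l f ->
  \int[mu]_(x in `[0, l]) f x = \int[mu]_(x in `[0, l / 2]) (f x + f (l - x)).
Proof.
move=> l0 fi; have h1 : 0 <= l / 2 by rewrite divr_ge0.
have h2 : l / 2 <= l by lra.
have i1 : integrable_on (l / 2) l f by exact: integrable_on_sub fi.
rewrite (Rint_split h1 h2 fi) RintD; last 2 first.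
- exact: integrable_on_sub fi.
- by apply: integrable_on_reflection i1; lra.
by congr (_ + _); rewrite (Rint_reflection _ _ i1)//; lra.
Qed.

Lemma ae_imp (P Q : R -> Prop) : (forall x, P x -> Q x) ->
  {ae mu, forall x, P x} -> {ae mu, forall x, Q x}.
Proof.
by move=> PQ [N [mN N0 sN]]; exists N; split => // x /= nQ; apply: sN => /= /PQ.
Qed.

Lemma Rint_ae_eq a b f g : measurable_fun `[a, b] f -> measurable_fun `[a, b] g ->
  {ae mu, forall x, `[a, b]%classic x -> f x = g x} ->
  \int[mu]_(x in `[a, b]) f x = \int[mu]_(x in `[a, b]) g x.
Proof.
move=> mf mg fg; congr fine; apply: ae_eq_integral => //; try exact/measurable_EFinP.
case: fg => N [mN N0 sN]; exists N; split => // x /= nfg.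
by apply: sN => /= fgx; apply: nfg => abx; rewrite /= fgx.
Qed.

End SquareIntegrable.

(** * Primitives of square integrable functions *)

Section AbsolutelyContinuous.
Context {R : realType}.
Local Notation mu := (@lebesgue_measure R).
Implicit Types (l : R) (f g u w v z : R -> R).

Definition primitive l u w := forall x, `[0, l]%classic x ->
  u x = u 0 + \int[mu]_(y in `[0, x]) w y.

Lemma primitive_continuous l w : integrable_on 0 l w ->
  {within `[0, l], continuous (fun x => \int[mu]_(y in `[0, x]) w y)}.
Proof.
move=> wi; have [l0|l0] := leP 0 l; first exact: parameterized_integral_continuous.
rewrite set_itv_ge; last by rewrite bnd_simp -ltNge.
exact: continuous_subspace0.
Qed.

Lemma primitive_L2on l u w : L2on 0 l w -> primitive l u w -> L2on 0 l u.
Proof.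
move=> w2 uw.
have := L2on_lin 1 (L2on_cst 0 l (u 0)) (L2on_continuous (primitive_continuous (L2on_int w2))).
by apply: L2on_eq => x /uw ->; rewrite mul1r.
Qed.

Lemma horner_primitive l (p : {poly R}) : primitive l (horner p) (horner p^`()).
Proof.
move=> x /=; rewrite in_itv/= => /andP[x0 xl].
have := x0; rewrite le_eqVlt => /predU1P[<-|{}x0].
  by rewrite set_itv1 Rintegral_set1 addr0.
rewrite /Rintegral (@continuous_FTC2 _ _ (horner p))//; first by rewrite -EFinB /= addrC subrK.
- exact/continuous_subspaceT/continuous_horner.
- split; first by move=> y _; exact: derivable_horner.
    by apply: cvg_at_right_filter; exact: continuous_horner.
  by apply: cvg_at_left_filter; exact: continuous_horner.
- by move=> y _; rewrite -derivE.
Qed.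

Lemma horner_L2on a b (p : {poly R}) : L2on a b (horner p).
Proof. exact/L2on_continuous/continuous_subspaceT/continuous_horner. Qed.

Lemma Rint_horner l (p : {poly R}) : 0 <= l ->
  \int[mu]_(x in `[0, l]) p^`().[x] = p.[l] - p.[0].
Proof.
move=> l0; rewrite (@horner_primitive l p l) /= ?in_itv/= ?l0 ?lexx//.
by rewrite addrAC subrr add0r.
Qed.

Lemma integrable_on_patch a b f : integrable_on a b f ->
  mu.-integrable setT (EFin \o f \_ `[a, b]).
Proof.
move=> fi; rewrite -restrict_EFin.
by have [/(_ fi) H _] := integrable_mkcond (mu := mu) (EFin \o f) (measurable_itv `[a, b]).
Qed.

(** Fubini's theorem for z x * w y on the triangle 0 <= y <= x <= l. *)
Lemma Rint_triangle l w z : 0 <= l -> integrable_on 0 l w -> integrable_on 0 l z ->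
  \int[mu]_(x in `[0, l]) (z x * \int[mu]_(y in `[0, x]) w y) =
  \int[mu]_(y in `[0, l]) (w y * \int[mu]_(x in `[y, l]) z x).
Proof.
move=> l0 wi zi.
pose zt := z \_ `[0, l]; pose wt := w \_ `[0, l].
have zti : mu.-integrable setT (EFin \o zt).
  exact: integrable_on_patch.
have wti : mu.-integrable setT (EFin \o wt).
  exact: integrable_on_patch.
have mz : measurable_fun setT zt by move/integrableP : zti => [/measurable_EFinP].
have mw : measurable_fun setT wt by move/integrableP : wti => [/measurable_EFinP].
pose h (p : R * R) : R := zt p.1 * (wt p.2 * (p.2 <= p.1)%R%:R).
have mh : measurable_fun [set: measurableTypeR R * measurableTypeR R] h.
  apply: measurable_funM; first exact: measurableT_comp.
  apply: measurable_funM; first exact: measurableT_comp.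
  apply: (@measurableT_comp _ _ _ _ _ _ (fun b : bool => b%:R : R)) => //.
  exact: measurable_fun_ler.
have hi : (mu \x mu)%E.-integrable [set: measurableTypeR R * measurableTypeR R] (EFin \o h).
  apply/integrable12ltyP; first exact/measurable_EFinP.
  pose W := (\int[mu]_y `|(wt y)%:E|)%E.
  have W0 : (0 <= W)%E by exact: integral_ge0.
  have Wfin : W \is a fin_num by rewrite ge0_fin_numE//; case/integrableP : wti.
  have mabs : measurable_fun [set: measurableTypeR R * measurableTypeR R]
      (fun p => `|(h p)%:E|)%E by do 2 apply: measurableT_comp => //.
  have mzE : measurable_fun [set: measurableTypeR R] (fun x => `|(zt x)%:E|)%E.
    by do 2 apply: measurableT_comp => //.
  have mwE : measurable_fun [set: measurableTypeR R] (fun x => `|(wt x)%:E|)%E.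
    by do 2 apply: measurableT_comp => //.
  apply: (@le_lt_trans _ _ (\int[mu]_x (`|(zt x)%:E| * W))%E).
    apply: ge0_le_integral => //.
    - by move=> x _; apply: integral_ge0.
    - exact: (@measurable_fun_fubini_tonelli_F _ _ (measurableTypeR R)
        (measurableTypeR R) R mu (fun p => `|(h p)%:E|%E) mabs (fun p => abse_ge0 _)).
    - exact: emeasurable_funM.
    - move=> x _; rewrite /W -ge0_integralZl//.
      apply: ge0_le_integral => //.
      + exact: (measurableT_comp mabs (pair1_measurable x)).
      + exact: emeasurable_funM.
      + move=> y _; rewrite -abseM -EFinM lee_fin /h /= !normrM.
        rewrite ler_wpM2l// ler_piMr//.
        by case: (y <= x); rewrite ?normr0 ?normr1.
  rewrite ge0_integralZr//.
  have Zfin : (\int[mu]_x `|(zt x)%:E|)%E \is a fin_num.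
    by rewrite ge0_fin_numE; [case/integrableP : zti|exact: integral_ge0].
  by rewrite -(fineK Wfin) -(fineK Zfin) -EFinM ltry.
have inner1 x : (\int[mu]_y (h (x, y))%:E)%E =
    (((fun x => z x * \int[mu]_(y in `[0, x]) w y) \_ `[0, l]) x)%:E.
  rewrite patchE; case: ifPn => [|xN] /=.
    rewrite inE/= in_itv/= => /andP[x0 xl].
    have wx : integrable_on 0 x w by exact: integrable_on_sub wi.
    have wxp := integrable_on_patch wx.
    rewrite (Rintegral_mkcond mu `[0, x]%classic) -RintegralZl// /Rintegral fineK; last first.
      apply: integrable_fin_num => //.
      exact: (integrableZl _ (z x) wxp).
    apply: eq_integral => y _; congr (_%:E); rewrite /h /zt /wt !patchE/=.
    rewrite mem_set; last by rewrite /= in_itv/= x0.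
    congr (_ * _).
    case: ifPn; rewrite ?inE ?notin_setE/= !in_itv/= => yl.
      case: ifPn; rewrite ?inE ?notin_setE/= !in_itv/= => yx.
        by case/andP : yx => _ ->; rewrite mulr1.
      case: (leP y x) => yx'; last by rewrite mulr0.
      by exfalso; apply: yx; case/andP : yl => ->.
    case: ifPn; rewrite ?inE ?notin_setE/= !in_itv/= => yx; last by rewrite mul0r.
    by exfalso; apply: yl; case/andP: yx => -> /le_trans; apply.
  apply: integral0_eq => y _; rewrite /h /zt patchE/=.
  by rewrite (negbTE xN) mul0r.
have inner2 y : (\int[mu]_x (h (x, y))%:E)%E =
    (((fun y => w y * \int[mu]_(x in `[y, l]) z x) \_ `[0, l]) y)%:E.
  rewrite patchE; case: ifPn => [|yN] /=.
    rewrite inE/= in_itv/= => /andP[y0 yl].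
    have zy : integrable_on y l z by exact: integrable_on_sub zi.
    have zyp := integrable_on_patch zy.
    rewrite (Rintegral_mkcond mu `[y, l]%classic) -RintegralZl// /Rintegral fineK; last first.
      apply: integrable_fin_num => //.
      exact: (integrableZl _ (w y) zyp).
    apply: eq_integral => x _; congr (_%:E); rewrite /h /zt /wt !patchE/=.
    rewrite [y \in _]mem_set; last by rewrite /= in_itv/= y0.
    rewrite mulrCA; congr (_ * _).
    case: ifPn; rewrite ?inE ?notin_setE/= !in_itv/= => xl.
      case: ifPn; rewrite ?inE ?notin_setE/= !in_itv/= => xy.
        by case/andP : xy => -> _; rewrite mulr1.
      case: (leP y x) => yx'; last by rewrite mulr0.
      by exfalso; apply: xy; case/andP : xl => _ ->; rewrite yx'.
    case: ifPn; rewrite ?inE ?notin_setE/= !in_itv/= => xy; last by rewrite mul0r.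
    by exfalso; apply: xl; case/andP: xy => /(le_trans y0) ->.
  apply: integral0_eq => x _; rewrite /h /wt patchE/=.
  by rewrite (negbTE yN) mul0r mulr0.
have /= := Fubini hi.
under eq_integral do rewrite inner1.
under [RHS]eq_integral do rewrite inner2.
by rewrite !(Rintegral_mkcond mu `[0, l]%classic) /Rintegral => ->.
Qed.

(** The functions u and v are primitives of functions that need not be
    continuous, so there is no product rule to integrate; after inserting the
    integrals for u and v, the identity becomes [Rint_triangle]. *)
Lemma integration_by_parts_primitive l u w v z : 0 <= l ->
  L2on 0 l w -> L2on 0 l z -> primitive l u w -> primitive l v z ->
  \int[mu]_(x in `[0, l]) (u x * z x) + \int[mu]_(x in `[0, l]) (w x * v x) =
  u l * v l - u 0 * v 0.
Proof.
move=> l0 w2 z2 uw vz.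
have wi := L2on_int w2; have zi := L2on_int z2.
have u2 := primitive_L2on w2 uw; have v2 := primitive_L2on z2 vz.
have inl : `[0, l]%classic l by rewrite /= in_itv/= l0 lexx.
have c0 c : L2on 0 l (fun=> c) by exact: L2on_cst.
have tri := Rint_triangle l0 wi zi.
have E1 : \int[mu]_(x in `[0, l]) (z x * \int[mu]_(y in `[0, x]) w y) =
    \int[mu]_(x in `[0, l]) (u x * z x) - u 0 * \int[mu]_(x in `[0, l]) z x.
  rewrite -mulNr -(RintZ (- u 0) zi) -RintD; last 2 first.
  - exact: L2on_mul.
  - exact: integrable_onZ.
  by apply: eq_Rint => x /uw ->; ring.
have E2 : \int[mu]_(y in `[0, l]) (w y * \int[mu]_(x in `[y, l]) z x) =
    v l * \int[mu]_(x in `[0, l]) w x - \int[mu]_(x in `[0, l]) (w x * v x).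
  rewrite -mulN1r -(RintZ (v l) wi) -RintZ; last exact: L2on_mul.
  rewrite -RintD; last 2 first.
  - exact: integrable_onZ.
  - apply: integrable_onZ; exact: L2on_mul.
  apply: eq_Rint => y yl; move: (yl); rewrite /= in_itv/= => /andP[y0 yl'].
  have := Rint_split y0 yl' zi; have := vz _ yl; have := vz _ inl.
  by move=> -> -> ->; ring.
move: tri; rewrite E1 E2; have := uw _ inl; have := vz _ inl.
by move=> -> ->; lra.
Qed.

End AbsolutelyContinuous.

(** * Square integrable functions on a metric graph *)

Section GraphSpace.
Context {R : realType} (G : metric_graph R).
Local Notation mu := (@lebesgue_measure R).
Local Notation fn := (edge G -> R -> R^o).
Implicit Types (f g h : fn).

Lemma L2_lin (a : R) f g : @L2 _ G f -> @L2 _ G g -> @L2 _ G (a *: f + g : fn).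
Proof. by move=> f2 g2 e; exact: (L2on_lin a (f2 e) (g2 e)). Qed.

Lemma L2_cst (c : R) : @L2 _ G (fun _ _ => c).
Proof. by move=> e; exact: L2on_cst. Qed.

Lemma L2innerC f g : @L2inner _ G f g = @L2inner _ G g f.
Proof.
by apply: eq_bigr => e _; apply: eq_Rint => x _; rewrite mulrC.
Qed.

Lemma L2inner_lin (a : R) f g h : @L2 _ G f -> @L2 _ G g -> @L2 _ G h ->
  @L2inner _ G (a *: f + g : fn) h = a * @L2inner _ G f h + @L2inner _ G g h.
Proof.
move=> f2 g2 h2; rewrite /L2inner /graph_int mulr_sumr -big_split/=.
apply: eq_bigr => e _.
have i1 := L2on_mul (f2 e) (h2 e); have i2 := L2on_mul (g2 e) (h2 e).
rewrite -(RintZ a i1) -RintD//; last exact: integrable_onZ.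
by apply: eq_Rint => x _; rewrite -[LHS]/((a * f e x + g e x) * h e x); ring.
Qed.

Lemma L2inner_ge0 f : 0 <= @L2inner _ G f f.
Proof.
apply: sumr_ge0 => e _; apply: Rintegral_ge0 => x _; rewrite -expr2; exact: sqr_ge0.
Qed.

Definition graph_space : prehilbert fn :=
  PreHilbert (L2_cst 0) L2_lin L2innerC L2inner_lin L2inner_ge0.

Lemma L2eq_nrm f g : @L2 _ G f -> @L2 _ G g -> @L2eq _ G f g ->
  nrm graph_space (f - g) = 0.
Proof.
move=> f2 g2 fg; rewrite /nrm /=.
suff -> : @L2inner _ G (f - g : fn) (f - g : fn) = 0 by rewrite sqrtr0.
apply: big1 => e _.
have [mf _] := f2 e; have [mg _] := g2 e.
have mfg : measurable_fun `[0, len G e] (fun x => (f e x - g e x) * (f e x - g e x)).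
  by apply: measurable_funM; apply: measurable_realfun.measurable_funB.
rewrite (@Rint_ae_eq _ 0 (len G e) _ (fun=> 0) mfg)//.
  by rewrite Rintegral_cst// mul0r.
apply: ae_imp (fg e) => x /= fgx xe.
by rewrite fgx// subrr mul0r.
Qed.

Lemma C0_semigroup_abstract T : @C0_semigroup _ G T -> c0_semigroup graph_space T.
Proof.
move=> [H1 H2 H3 H4]; split.
- move=> t t0; have [h1 h2 h3] := H1 _ t0; split => // a f g f2 g2.
  apply: L2eq_nrm; [exact/h1/L2_lin|apply: L2_lin; exact: h1|exact: h2].
- move=> f f2; apply: L2eq_nrm => //; last exact: H2.
  by have [h1 _ _] := H1 _ (lexx 0); exact: h1.
- move=> s t f s0 t0 f2; apply: L2eq_nrm; last exact: H3.
    by have [h1 _ _] := H1 _ (addr_ge0 s0 t0); exact: h1.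
  have [h1 _ _] := H1 _ s0; have [h2 _ _] := H1 _ t0; exact/h1/h2.
- exact: H4.
Qed.

Variable D : {set vertex G}.

(** Testing the weak equation with f itself gives <f, g> = - |f'|^2. *)
Lemma laplacian_dissipative f g : laplacian D f g -> @L2inner _ G f g <= 0.
Proof.
move=> [f2 g2 [u [w [uf uD Huw]]]].
have [uw _ _] := uD; have [w2 uw'] := uw.
have u2 e : L2on 0 (len G e) (u e) by apply: (primitive_L2on (w2 e)); exact: uw'.
have -> : L2inner f g = - L2inner w w.
  rewrite (Huw _ _ uD) /L2inner /graph_int -sumrN; apply: eq_bigr => e _.
  have i1 := L2on_mul (f2 e) (g2 e); have i2 := L2on_mul (g2 e) (u2 e).
  rewrite -mulN1r -RintZ; last first.
    by apply: integrable_on_eq (integrable_onZ (-1) i2) => x _; ring.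
  have [mf _] := f2 e; have [mg _] := g2 e; have [mu' _] := u2 e.
  apply: Rint_ae_eq.
  - exact: measurable_funM.
  - by do 2 (apply: measurable_funM => //); exact: measurableT_comp.
  - apply: ae_imp (uf e) => x ufx xe; rewrite -ufx//; ring.
by rewrite oppr_le0; exact: L2inner_ge0.
Qed.

Lemma graph_int_lin (a : R) f g : @L2 _ G f -> @L2 _ G g ->
  @graph_int _ G (a *: f + g : fn) = a * @graph_int _ G f + @graph_int _ G g.
Proof.
move=> f2 g2; rewrite /graph_int mulr_sumr -big_split/=; apply: eq_bigr => e _.
have i1 := L2on_int (f2 e); have i2 := L2on_int (g2 e).
by rewrite -(RintZ a i1) -RintD//; exact: integrable_onZ.
Qed.

(** The integral is the inner product with the constant 1. *)
Lemma graph_int_eqv f g : @L2 _ G f -> @L2 _ G g ->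
  nrm graph_space (f - g) = 0 -> @graph_int _ G f = @graph_int _ G g.
Proof.
have key f' g' : @L2 _ G f' -> @L2 _ G g' ->
  nrm graph_space (f' - g') = 0 -> @graph_int _ G f' <= @graph_int _ G g'.
  move=> f2 g2 fg; rewrite -subr_le0.
  have d2 : @L2 _ G (f' - g' : fn) by exact: (@domB _ _ graph_space).
  have -> : @graph_int _ G f' - @graph_int _ G g' = ip graph_space (f' - g') (fun _ _ => 1).
    rewrite -(addrK (- @graph_int _ G g') (@graph_int _ G f')) opprK.
    have /= := graph_int_lin 1 d2 g2; rewrite scale1r subrK mul1r => ->.
    rewrite addrK addrK; apply: eq_bigr => e _.
    by apply: eq_Rint => x _; rewrite mulr1.
  apply: le_trans (cauchy_schwarz _ _) _ => //; first exact: L2_cst.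
  by rewrite fg mul0r.
move=> f2 g2 fg; apply/eqP; rewrite eq_le !key//.
by rewrite nrm_distC.
Qed.

End GraphSpace.

(** * Heat content as the integral of the evolved constant *)

Section KernelIntegral.
Context {R : realType}.
Local Notation mu := (@lebesgue_measure R).

(** The sections of k need not be integrable, so Fubini's theorem is not
    available; Tonelli's theorem for the positive and negative parts is. *)
Lemma measurable_Rint_section (a b a' b' : R) (k : R -> R -> R) :
  measurable_fun (`[a, b]%classic `*` `[a', b']%classic) (fun xy : R * R => k xy.1 xy.2) ->
  measurable_fun `[a, b]%classic (fun x => \int[mu]_(y in `[a', b']) k x y).
Proof.
move=> mk.
pose K : measurableTypeR R * measurableTypeR R -> R :=
  (fun xy : R * R => k xy.1 xy.2) \_ (`[a, b]%classic `*` `[a', b']%classic).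
have mK : measurable_fun setT (EFin \o K).
  apply/measurable_EFinP; apply/(measurable_restrictT _ _).1 => //.
  exact: measurableX.
pose F (x : measurableTypeR R) : \bar R := (\int[mu]_y (K (x, y))%:E)%E.
have mF : measurable_fun [set: measurableTypeR R] F.
  have -> : F = (fun x => \int[mu]_y ((EFin \o K)^\+ (x, y)) -
      \int[mu]_y ((EFin \o K)^\- (x, y)))%E.
    apply/funext => x; rewrite /F integralE; congr (_ - _)%E.
      by apply: eq_integral => y _; rewrite -[LHS]/((((EFin \o K) \o pair x)^\+)%E y) funepos_comp.
    by apply: eq_integral => y _; rewrite -[LHS]/((((EFin \o K) \o pair x)^\-)%E y) funeneg_comp.
  apply: emeasurable_funB.
    exact: (@measurable_fun_fubini_tonelli_F _ _ (measurableTypeR R) (measurableTypeR R)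
      R mu _ (measurable_funepos mK) (fun p => funepos_ge0 _ p)).
  exact: (@measurable_fun_fubini_tonelli_F _ _ (measurableTypeR R) (measurableTypeR R)
    R mu _ (measurable_funeneg mK) (fun p => funeneg_ge0 _ p)).
apply: (@eq_measurable_fun _ _ _ _ _ (fine \o F)); last first.
  by apply: measurable_funTS; apply: measurableT_comp.
move=> x; rewrite inE => xab; congr fine; rewrite [RHS]integral_mkcond.
apply: eq_integral => y _; rewrite /K !patchE in_setX/= mem_set//=.
by case: ifP.
Qed.

End KernelIntegral.

Section HeatContent.
Context {R : realType} (G : metric_graph R).
Local Notation mu := (@lebesgue_measure R).

(** The inner integral is the kernel applied to the constant 1. *)
Lemma kernel_graph_int (S : graph_fun G -> graph_fun G) (k : graph_kernel G) :
  integral_kernel S k -> (forall f, L2 f -> L2 (S f)) ->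
  graph_int (fun e x => graph_int (fun e' y => k e x e' y)) =
  graph_int (S (fun _ _ => 1)).
Proof.
move=> [mk Hk] SL; apply: eq_bigr => e _.
have one : @L2 _ G (fun _ _ => 1) by exact: L2_cst.
apply: Rint_ae_eq; last first.
- apply: ae_imp (Hk _ one e) => x H xe; have [_ ->] := H xe.
  by apply: eq_bigr => e' _; apply: eq_Rint => y _; rewrite mulr1.
- by have [] := SL _ one e.
- apply: measurable_sum => e'.
  exact: (measurable_Rint_section (k := fun x y => k e x e' y) (mk e e')).
Qed.

End HeatContent.

(** * Approximation of the constant 1 in the domain of the Laplacian *)

Section CutoffPolynomial.
Context {R : realType}.
Local Notation mu := (@lebesgue_measure R).
Implicit Types (l x : R) (n m : nat).

(** The affine function mapping [0, l] onto [-1, 1]. *)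
Definition centred l : {poly R} := (2 / l) *: 'X - 1.

(** Both factors of the square vanish at the ends of [0, l], so the derivative
    vanishes there too; inside the interval the values tend to 1 as n
    grows. *)
Definition cutoff l n : {poly R} := (1 - centred l ^+ (2 * n)) ^+ 2.

Lemma horner_centred l x : (centred l).[x] = 2 / l * x - 1.
Proof. by rewrite /centred !hornerE. Qed.

Lemma centred0 l : (centred l).[0] = -1.
Proof. by rewrite horner_centred mulr0 sub0r. Qed.

Lemma centred_len l : 0 < l -> (centred l).[l] = 1.
Proof. by move=> l0; rewrite horner_centred divfK ?gt_eqF//; ring. Qed.

Lemma deriv_centred l : (centred l)^`() = (2 / l)%:P.
Proof. by rewrite /centred derivB derivZ derivX derivC subr0 alg_polyC. Qed.

Lemma cutoff_boundary l n : 0 < l ->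
  [/\ (cutoff l n).[0] = 0, (cutoff l n).[l] = 0,
      (cutoff l n)^`().[0] = 0 & (cutoff l n)^`().[l] = 0].
Proof.
move=> l0.
have e0 : (1 - centred l ^+ (2 * n)).[0] = 0.
  by rewrite hornerD hornerN hornerC horner_exp centred0 exprM sqrrN expr1n expr1n subrr.
have el : (1 - centred l ^+ (2 * n)).[l] = 0.
  by rewrite hornerD hornerN hornerC horner_exp centred_len// expr1n subrr.
by rewrite /cutoff expr2 derivM !hornerD !hornerM e0 el !(mul0r, mulr0) addr0.
Qed.

Lemma Rint_centred_exp l m : 0 < l ->
  \int[mu]_(x in `[0, l]) (centred l ^+ (2 * m)).[x] = l / (2 * m).+1%:R.
Proof.
move=> l0; have N0 : 0 < 1 + 2 * m%:R :> R by rewrite ltr_wpDr// mulr_ge0.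
pose P : {poly R} := (l / 2 / (2 * m).+1%:R) *: centred l ^+ (2 * m).+1.
have -> : centred l ^+ (2 * m) = P^`().
  rewrite /P derivZ deriv_exp deriv_centred /= mul_polyC -(scaler_nat _ (_ *: _)) !scalerA.
  rewrite -[LHS]scale1r; congr (_ *: _); field.
  by rewrite !gt_eqF.
rewrite Rint_horner ?ltW// /P !hornerZ !horner_exp centred0 centred_len//.
by rewrite expr1n exprS exprM sqrrN !expr1n; field; rewrite gt_eqF.
Qed.

(** With r = centred^(2n) in [0, 1], 1 - (1 - r)^2 = r (2 - r) <= 2 r. *)
Lemma cutoff_close l n x : 0 < l -> `[0, l]%classic x ->
  (1 - (cutoff l n).[x]) ^+ 2 <= 4 * (centred l ^+ (2 * (2 * n))).[x].
Proof.
move=> l0 /=; rewrite in_itv/= => /andP[x0 xl].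
have -> : (cutoff l n).[x] = (1 - (centred l).[x] ^+ (2 * n)) ^+ 2.
  by rewrite /cutoff horner_exp hornerD hornerN hornerC horner_exp.
rewrite horner_exp [(2 * (2 * n))%N]mulnC (exprM _ (2 * n) 2).
have r1 : `|(centred l).[x]| <= 1.
  rewrite horner_centred ler_norml; apply/andP; split.
    by rewrite -subr_ge0 opprK subrK mulr_ge0// divr_ge0// ltW.
  by rewrite lerBlDr mulrAC ler_pdivrMr//; lra.
set r := (centred l).[x] ^+ (2 * n).
have r0 : 0 <= r by rewrite /r exprM exprn_ge0// sqr_ge0.
have {}r1 : r <= 1 by rewrite /r exprM -real_normK ?num_real// -exprM exprn_ile1.
have -> : (1 - (1 - r) ^+ 2) ^+ 2 = r ^+ 2 * (2 - r) ^+ 2 by ring.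
rewrite mulrC ler_wpM2r ?sqr_ge0//; nra.
Qed.

End CutoffPolynomial.

Section Density.
Context {R : realType} (G : metric_graph R) (D : {set vertex G}).
Local Notation mu := (@lebesgue_measure R).
Local Notation fn := (edge G -> R -> R^o).

(** A function that vanishes with its derivative at all edge ends satisfies
    every vertex condition, and produces no boundary term when integrated by
    parts against a test function. *)
Lemma laplacian_cutoff n :
  laplacian D (fun e x => (cutoff (len G e) n).[x])
              (fun e x => ((cutoff (len G e) n)^`()^`()).[x]).
Proof.
have bd (e : edge G) := cutoff_boundary n (len_gt0 e).
have bd0 e b : (cutoff (len G e) n).[edge_point e b] = 0.
  by have [? ? _ _] := bd e; case: b.
have L2h (p : edge G -> {poly R}) : @L2 _ G (fun e x => (p e).[x]).
  by move=> e; exact: horner_L2on.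
split; [exact: L2h|exact: L2h|].
exists (fun e x => (cutoff (len G e) n).[x]), (fun e x => (cutoff (len G e) n)^`().[x]).
split.
- by move=> e; apply: aeW.
- split; last by move=> e b _.
    by split; [exact: L2h|move=> e x; exact: horner_primitive].
  by move=> e b e' b' _; rewrite !bd0.
- move=> v z [[z2 vz] _ _]; apply: eq_bigr => e _.
  have [_ _ d0 dl] := bd e.
  have := integration_by_parts_primitive (ltW (len_gt0 e)) (horner_L2on _ _ _) (z2 e)
    (@horner_primitive _ (len G e) (cutoff (len G e) n)^`()) (vz e).
  rewrite d0 dl !mul0r subrr => /eqP; rewrite addr_eq0 => /eqP ->.
  rewrite -mulN1r -RintZ; last first.
    apply: L2on_mul; first exact: horner_L2on.
    by apply: (primitive_L2on (z2 e)); exact: vz.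
  by apply: eq_Rint => x _; rewrite mulN1r mulNr.
Qed.

(** By [cutoff_close] the squared distance to 1 is at most the sum over the
    edges of 4 * len / (4n + 1). *)
Lemma laplacian_dense_at_one eps : 0 < eps -> exists h g : fn,
  laplacian D h g /\ nrm (graph_space G) ((fun _ _ => 1) - h) < eps.
Proof.
move=> eps0; pose L := \sum_(e : edge G) 4 * len G e.
have L0 : 0 <= L by apply: sumr_ge0 => e _; rewrite mulr_ge0// ltW// len_gt0.
have [n Hn] : exists n : nat, L / eps ^+ 2 < n%:R.
  by exists (Num.truncn (L / eps ^+ 2)).+1; exact: truncnS_gt.
exists (fun e x => (cutoff (len G e) n).[x]), (fun e x => ((cutoff (len G e) n)^`()^`()).[x]).
split; first exact: laplacian_cutoff.
rewrite -(ltr_pXn2r (ltn0Sn 1)) ?nnegrE ?nrm_ge0 ?(ltW eps0)// sqr_nrm /=.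
have e20 : 0 < eps ^+ 2 by rewrite exprn_gt0.
apply: (@le_lt_trans _ _ (L / (2 * (2 * n)).+1%:R)); last first.
  rewrite ltr_pdivrMr// mulrC -ltr_pdivrMr//; apply: lt_le_trans Hn _.
  by rewrite ler_nat; lia.
rewrite /L mulr_suml; apply: ler_sum => e _.
have l0 := len_gt0 e.
rewrite -mulrA -Rint_centred_exp// -RintZ; last exact/L2on_int/horner_L2on.
apply: le_Rintegral.
- exact: measurable_itv.
- have h2 : L2on 0 (len G e) (fun x => 1 - (cutoff (len G e) n).[x]).
    have := L2on_lin (-1) (horner_L2on 0 (len G e) (cutoff (len G e) n)) (L2on_cst 0 (len G e) 1).
    by apply: L2on_eq => x _; rewrite mulN1r addrC.
  exact: (L2on_mul h2 h2).
- by apply: integrable_onZ; exact/L2on_int/horner_L2on.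
- by move=> x xe; rewrite -expr2; exact: cutoff_close.
Qed.

End Density.

(** * Folding an interval at its midpoint *)

Section Folding.
Context {R : realType}.
Local Notation mu := (@lebesgue_measure R).
Implicit Types (l m c s x y : R) (f g r u v w z : R -> R).

Lemma integrable_onN m z : integrable_on 0 m z -> integrable_on 0 m (fun x => - z x).
Proof. by move=> zi; apply: integrable_on_eq (integrable_onZ (-1) zi) => x _; rewrite mulN1r. Qed.

Lemma primitive_sub l m v z : m <= l -> primitive l v z -> primitive m v z.
Proof.
move=> ml vz x /=; rewrite in_itv/= => /andP[x0 xm].
by apply: vz; rewrite /= in_itv/= x0 (le_trans xm ml).
Qed.

Lemma primitive_lin m c v z v' z' : integrable_on 0 m z -> integrable_on 0 m z' ->
  primitive m v z -> primitive m v' z' ->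
  primitive m (fun x => c * v x + v' x) (fun x => c * z x + z' x).
Proof.
move=> zi zi' vz vz' x xm; rewrite (vz _ xm) (vz' _ xm).
move: xm; rewrite /= in_itv/= => /andP[x0 xm].
have i1 : integrable_on 0 x z by exact: integrable_on_sub zi.
have i2 : integrable_on 0 x z' by exact: integrable_on_sub zi'.
by rewrite RintD ?RintZ//; [ring|exact: integrable_onZ].
Qed.

Lemma primitive_scale m c v z : integrable_on 0 m z -> primitive m v z ->
  primitive m (fun x => c * v x) (fun x => c * z x).
Proof.
move=> zi vz x xm; rewrite (vz _ xm).
move: xm; rewrite /= in_itv/= => /andP[x0 xm].
have i1 : integrable_on 0 x z by exact: integrable_on_sub zi.
by rewrite RintZ// mulrDr.
Qed.

Lemma primitive_eq m v z v' z' :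
  (forall x, v x = v' x) -> (forall x, z x = z' x) ->
  primitive m v z -> primitive m v' z'.
Proof. by move=> /funext -> /funext ->. Qed.

Lemma primitive_reflection m v z : integrable_on 0 m z -> primitive m v z ->
  primitive m (fun x => v (m - x)) (fun x => - z (m - x)).
Proof.
move=> zi vz x; rewrite /= in_itv/= => /andP[x0 xm].
have m0 : 0 <= m by exact: le_trans xm.
have i1 : integrable_on (m - x) m z by apply: integrable_on_sub zi => //; lra.
have i2 : integrable_on 0 x (fun y => z (m - y)) by apply: integrable_on_reflection i1; lra.
have E : \int[mu]_(y in `[0, x]) - z (m - y) = - \int[mu]_(y in `[m - x, m]) z y.
  rewrite -(@Rint_reflection _ m (m - x) m 0 x z)//; try lra.
  rewrite -[RHS]mulN1r -RintZ//; apply: eq_Rint => y _; ring.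
have s1 : 0 <= m - x by lra.
have s2 : m - x <= m by lra.
have a1 : `[0, m]%classic m by rewrite /= in_itv/= m0 lexx.
have a2 : `[0, m]%classic (m - x) by rewrite /= in_itv/= s1 s2.
rewrite E subr0 (vz _ a1) (vz _ a2) (Rint_split s1 s2 zi); ring.
Qed.

Lemma L2on_restrict a b c d (A : set R) r : measurable A -> A `<=` `[c, d] ->
  L2on c d r -> L2on a b (r \_ A).
Proof.
move=> mA Acd [mr ri].
have mab : measurable `[a, b]%classic by exact: measurable_itv.
have mI : measurable (`[a, b]%classic `&` A) by exact: measurableI.
have sub : `[a, b]%classic `&` A `<=` `[c, d]%classic by move=> x [_ /Acd].
split.
  have [H _] := measurable_restrict r mA mab.
  by apply: H; apply: measurable_funS mr.
have [H _] := integrable_restrict mu mA mab (fun x => (r x ^+ 2)%:E).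
have {}H : mu.-integrable `[a, b] ((fun x => (r x ^+ 2)%:E) \_ A).
  by apply: H; apply: integrableS ri.
apply: eq_integrable H => // x _; rewrite !patchE.
by case: ifP => // _; rewrite expr0n.
Qed.

(** The even (s = 1) or odd (s = -1) extension about the midpoint l / 2. *)
Definition mirror_ext s l r x := if x <= l / 2 then r x else s * r (l - x).

(** The half-open interval in the first summand keeps the midpoint from being
    counted twice. *)
Lemma mirror_extE s l r x : 0 <= x -> x <= l -> mirror_ext s l r x =
   s * (r \_ `[0, l / 2[%classic) (l - x) + (r \_ `[0, l / 2]%classic) x.
Proof.
move=> x0 xl; rewrite /mirror_ext !patchE.
case: (leP x (l / 2)) => xl2.
  have -> : (x \in `[0, l / 2]%classic) = true by apply: mem_set; rewrite /= in_itv/= x0.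
  have -> : (l - x \in `[0, l / 2[%classic) = false.
    by apply: memNset; rewrite /= in_itv/= => /andP[_]; lra.
  by rewrite mulr0 add0r.
have -> : (x \in `[0, l / 2]%classic) = false.
  by apply: memNset; rewrite /= in_itv/= => /andP[_]; lra.
have -> : (l - x \in `[0, l / 2[%classic) = true.
  by apply: mem_set; rewrite /= in_itv/=; apply/andP; split; lra.
by rewrite addr0.
Qed.

Lemma L2on_mirror_ext s l r : L2on 0 (l / 2) r -> L2on 0 l (mirror_ext s l r).
Proof.
move=> r2.
have h1 : L2on 0 l (r \_ `[0, l / 2]%classic) by exact: (L2on_restrict _ _ _ _ r2).
have h2 : L2on 0 l (r \_ `[0, l / 2[%classic).
  by apply: (L2on_restrict _ _ _ _ r2) => // x /=; rewrite !in_itv/= => /andP[-> /ltW ->].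
have h3 : L2on 0 l (fun x => (r \_ `[0, l / 2[%classic) (l - x)).
  by apply: L2on_reflection h2; rewrite ?subrr ?subr0.
apply: L2on_eq (L2on_lin s h3 h1) => x /=; rewrite in_itv/= => /andP[x0 xl].
by rewrite mirror_extE.
Qed.

Lemma eq_Rint_co a b f g : integrable_on a b f -> integrable_on a b g ->
  (forall x, a <= x -> x < b -> f x = g x) ->
  \int[mu]_(x in `[a, b]) f x = \int[mu]_(x in `[a, b]) g x.
Proof.
move=> fi gi fg.
have sub : `[a, b[%classic `<=` `[a, b]%classic.
  by move=> x /=; rewrite !in_itv/= => /andP[-> /ltW ->].
have ico h : integrable_on a b h -> mu.-integrable [set` Interval (BLeft a) (BLeft b)] (EFin \o h).
  by apply: integrableS.
rewrite -!Rintegral_itv_bndo_bndc; [|exact: ico|exact: ico].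
apply: eq_Rintegral => x; rewrite inE/= in_itv/= => /andP[ax xb]; exact: fg.
Qed.

Lemma Rint_mirror_ext s l f r : 0 <= l -> L2on 0 l f -> L2on 0 (l / 2) r ->
  \int[mu]_(x in `[0, l]) (f x * mirror_ext s l r x) =
  \int[mu]_(x in `[0, l / 2]) ((f x + s * f (l - x)) * r x).
Proof.
move=> l0 f2 r2; have e2 := L2on_mirror_ext s r2.
have h2 : l / 2 <= l by lra.
have fr2 : L2on 0 l (fun x => f (l - x)) by apply: L2on_reflection f2; lra.
have er2 : L2on 0 l (fun x => mirror_ext s l r (l - x)) by apply: L2on_reflection e2; lra.
rewrite (Rint_fold l0 (L2on_mul f2 e2)).
have sub g : L2on 0 l g -> L2on 0 (l / 2) g by exact: L2on_sub.
(* The folded integrand differs from the target at x = l / 2, unless s = 1. *)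
apply: eq_Rint_co.
- by apply: integrable_onD; apply: L2on_mul; exact: sub.
- apply: L2on_mul => //.
  by apply: L2on_eq (L2on_lin s (sub _ fr2) (sub _ f2)) => x _; rewrite addrC.
- move=> x x0 xl; rewrite /mirror_ext ltW//.
  by rewrite ifF; [rewrite opprB addrCA subrr addr0; ring|apply/negP; lra].
Qed.

(** The derivative of an even function is odd. *)
Lemma primitive_mirror_ext l r r' : 0 <= l -> L2on 0 (l / 2) r' -> primitive (l / 2) r r' ->
  primitive l (mirror_ext 1 l r) (mirror_ext (-1) l r').
Proof.
move=> l0 r2 rr x /=; rewrite in_itv/= => /andP[x0 xl].
have h0 : 0 <= l / 2 by lra.
have e0 : mirror_ext 1 l r 0 = r 0 by rewrite /mirror_ext h0.
have ei := L2on_int (L2on_mirror_ext (-1) r2).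
have left y : 0 <= y -> y <= l / 2 ->
    \int[mu]_(t in `[0, y]) mirror_ext (-1) l r' t = r y - r 0.
  move=> y0 yl; rewrite (rr y) /= ?in_itv/= ?y0// addrAC subrr add0r.
  apply: eq_Rint => t /=; rewrite in_itv/= => /andP[t0 ty].
  by rewrite /mirror_ext (le_trans ty yl).
rewrite e0 {1}/mirror_ext; case: (leP x (l / 2)) => xl2; first by rewrite left// addrC subrK.
have ix : integrable_on 0 x (mirror_ext (-1) l r') by exact: integrable_on_sub ei.
rewrite (Rint_split h0 (ltW xl2) ix) left//.
have k0 : 0 <= l - x by lra.
have k1 : l - x <= l / 2 by lra.
have kx : `[0, (l / 2)]%classic (l - x) by rewrite /= in_itv/= k0.
have kl : `[0, (l / 2)]%classic (l / 2) by rewrite /= in_itv/= h0 lexx.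
have i1 : integrable_on (l - x) (l / 2) r' by apply: integrable_on_sub (L2on_int r2).
have i2 : integrable_on (l / 2) x (fun y => r' (l - y)) by apply: integrable_on_reflection i1; lra.
have -> : \int[mu]_(t in `[(l / 2), x]) mirror_ext (-1) l r' t =
    - \int[mu]_(y in `[(l - x), (l / 2)]) r' y.
  rewrite -(@Rint_reflection _ l (l - x) (l / 2) (l / 2) x r')//; try lra.
  rewrite -[RHS]mulN1r -RintZ//.
  (* At the midpoint [mirror_ext] takes the value of its other branch. *)
  have sub : `](l / 2), x]%classic `<=` `[(l / 2), x]%classic.
    by move=> y /=; rewrite !in_itv/= => /andP[/ltW -> ->].
  have ioc h : integrable_on (l / 2) x h ->
      mu.-integrable [set` Interval (BRight (l / 2)) (BRight x)] (EFin \o h).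
    by apply: integrableS.
  have j1 : integrable_on (l / 2) x (mirror_ext (-1) l r') by apply: integrable_on_sub ei; lra.
  have j2 : integrable_on (l / 2) x (fun y => -1 * r' (l - y)) by exact: integrable_onZ.
  rewrite -[LHS]Rintegral_itv_obnd_cbnd; last exact: ioc.
  rewrite -[RHS]Rintegral_itv_obnd_cbnd; last exact: ioc.
  apply: eq_Rintegral => y; rewrite inE/= in_itv/= => /andP[ly yx].
  by rewrite /mirror_ext ifF//; apply/negP; lra.
have := rr _ kx; have := rr _ kl; have := Rint_split k0 k1 (L2on_int r2).
by move=> -> -> ->; ring.
Qed.

Lemma ae_reflection c a b a' b' (P : R -> Prop) : a' = c - b -> b' = c - a ->
  {ae mu, forall x, `[a, b]%classic x -> P x} ->
  {ae mu, forall x, `[a', b']%classic x -> P (c - x)}.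
Proof.
move=> -> -> [N [mN N0 sN]].
exists ((fun x => c - x) @^-1` N); split.
- by rewrite -[X in measurable X]setTI; apply: measurable_reflection.
- by have := lebesgue_measure_reflection c mN; rewrite N0.
move=> x /= nP; apply: sN => /= H; apply: nP => xab; apply: H.
by move: xab; rewrite !in_itv/= => /andP[? ?]; apply/andP; split; lra.
Qed.

End Folding.

(** * Averaging over the reflection of the loop *)

Lemma big_option_sum (R : nmodType) (I : finType) (F : option I -> R) :
  \sum_(i : option I) F i = F None + \sum_(i : I) F (Some i).
Proof.
rewrite -big_enum/= (perm_big (None :: map Some (enum I))) ?big_cons ?big_map ?big_enum//.
apply: uniq_perm; rewrite ?enum_uniq//=.
  rewrite map_inj_uniq ?enum_uniq ?andbT; last by move=> x y [].
  by apply/mapP => -[].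
move=> [x|]; rewrite mem_enum !inE//=.
by rewrite map_f// mem_enum.
Qed.

Section Averaging.
Context {R : realType} (G : metric_graph R) (e0 : edge G).
Local Notation mu := (@lebesgue_measure R).
Local Notation G' := (midpoint_cut e0).
Local Notation l := (len G e0).
Implicit Types (s : R).

(** The average over the reflection of the loop. The sign s is 1 for functions
    and -1 for their derivatives, since the derivative of u (l - x) is
    - u' (l - x). *)
Definition fold_avg s (f : edge G -> R -> R) x := 2^-1 * (f e0 x + s * f e0 (l - x)).

(** On the edge [None], which is the second half of the loop translated to start
    at 0, the coordinate x is the point l / 2 + x, the mirror image of
    l / 2 - x. *)
Definition cut_avg s (f : edge G -> R -> R) : edge G' -> R -> R := fun j x =>
  match j with
  | Some i => if i == e0 then fold_avg s f x else f i x
  | None => s * fold_avg s f (l / 2 - x)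
  end.

(** The average over the exchange of the two pendant edges. *)
Definition pair_avg s (v : edge G' -> R -> R) x :=
  2^-1 * (v (Some e0) x + s * v None (l / 2 - x)).

(** The adjoint of [cut_avg], see [cut_avg_adjoint]. *)
Definition unfold_avg s (v : edge G' -> R -> R) : edge G -> R -> R := fun i x =>
  if i == e0 then mirror_ext s l (pair_avg s v) x else v (Some i) x.

Let l0 : 0 < l. Proof. exact: len_gt0. Qed.
Let h0 : 0 <= l / 2. Proof. by rewrite divr_ge0// ltW. Qed.
Let hl : l / 2 <= l. Proof. by have := l0; lra. Qed.

Lemma len_cut i : len G' (Some i) = if i == e0 then l / 2 else len G i.
Proof. by []. Qed.

Lemma len_cut0 : len G' (Some e0) = l / 2.
Proof. by rewrite len_cut eqxx. Qed.

Lemma fold_avg_L2 s f : @L2 _ G f -> L2on 0 l (fold_avg s f).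
Proof.
move=> f2; apply: L2on_scale.
have := L2on_lin s (L2on_reflection (c := l) (esym (subrr l)) (esym (subr0 l)) (f2 e0)) (f2 e0).
by apply: L2on_eq => x _; rewrite addrC.
Qed.

Lemma cut_avg_L2 s f : @L2 _ G f -> @L2 _ G' (cut_avg s f).
Proof.
move=> f2 [i|] /=; last first.
  apply: (@L2on_scale _ 0 (l / 2)).
  apply: (@L2on_reflection _ _ 0 (l / 2)); rewrite ?subrr ?subr0//.
  by apply: L2on_sub (fold_avg_L2 s f2).
rewrite /edge_itv len_cut /cut_avg; case: eqP => [_|_]; last exact: f2.
by apply: (@L2on_sub _ 0 l) (fold_avg_L2 s f2).
Qed.

Lemma pair_avg_L2 s v : @L2 _ G' v -> L2on 0 (l / 2) (pair_avg s v).
Proof.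
move=> v2; apply: L2on_scale.
have r2 : L2on 0 (l / 2) (fun x => v None (l / 2 - x)).
  by apply: L2on_reflection (v2 None); rewrite /= ?subrr ?subr0.
have := v2 (Some e0); rewrite /edge_itv len_cut0 => v1.
by apply: L2on_eq (L2on_lin s r2 v1) => x _; rewrite addrC.
Qed.

Lemma unfold_avg_L2 s v : @L2 _ G' v -> @L2 _ G (unfold_avg s v).
Proof.
move=> v2 i; rewrite /unfold_avg; case: eqP => [->|/eqP ie].
  exact/L2on_mirror_ext/pair_avg_L2.
by have := v2 (Some i); rewrite /edge_itv len_cut (negbTE ie).
Qed.

Lemma graph_int_cut_avg f : (forall i, integrable_on 0 (len G i) (f i)) ->
  @graph_int _ G' (cut_avg 1 f) = @graph_int _ G f.
Proof.
move=> fi; rewrite /graph_int big_option_sum (bigD1 e0)//= [RHS](bigD1 e0)//= addrA.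
congr (_ + _); last first.
  apply: eq_bigr => i ie; rewrite /edge_itv len_cut (negbTE ie).
  by apply: eq_Rint => x _.
rewrite /edge_itv len_cut0 /= eqxx.
have r1 : integrable_on 0 l (fun x => f e0 (l - x)).
  by apply: integrable_on_reflection (fi e0); rewrite ?subrr ?subr0.
have s1 : integrable_on 0 l (fun x => f e0 x + f e0 (l - x)) by exact: integrable_onD.
have s2 : integrable_on 0 (l / 2) (fun x => f e0 x + f e0 (l - x)) by exact: integrable_on_sub s1.
have s3 : integrable_on 0 (l / 2) (fold_avg 1 f).
  by apply: integrable_on_eq (integrable_onZ 2^-1 s2) => x _; rewrite /fold_avg mul1r.
have E : \int[mu]_(x in `[0, l / 2]) (1 * fold_avg 1 f (l / 2 - x)) =
    \int[mu]_(x in `[0, l / 2]) fold_avg 1 f x.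
  rewrite -(Rint_reflection (c := l / 2) (esym (subrr _)) (esym (subr0 _)) s3).
  by apply: eq_Rint => x _; rewrite mul1r.
rewrite E -RintD// (Rint_fold (ltW l0) (fi e0)).
by apply: eq_Rint => x _; rewrite /fold_avg; field.
Qed.

Lemma cut_avg_adjoint s f v : @L2 _ G f -> @L2 _ G' v ->
  @L2inner _ G' (cut_avg s f) v = @L2inner _ G f (unfold_avg s v).
Proof.
move=> f2 v2; rewrite /L2inner /graph_int big_option_sum.
rewrite (bigD1 e0)//= [RHS](bigD1 e0)//= addrA; congr (_ + _); last first.
  apply: eq_bigr => i ie; rewrite /edge_itv len_cut (negbTE ie).
  by apply: eq_Rint => x _; rewrite /unfold_avg (negbTE ie).
rewrite /edge_itv len_cut0 /= /unfold_avg eqxx.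
have p2 := pair_avg_L2 s v2; have hf2 := fold_avg_L2 s f2.
rewrite (Rint_mirror_ext s (ltW l0) (f2 e0) p2).
have v1 := v2 (Some e0); rewrite /edge_itv len_cut0 in v1.
have hf2' : L2on 0 (l / 2) (fold_avg s f) by exact: L2on_sub hf2.
have r1 : L2on 0 (l / 2) (fun x => fold_avg s f (l / 2 - x)).
  by apply: L2on_reflection hf2'; rewrite ?subrr ?subr0.
have rv : L2on 0 (l / 2) (fun x => v None (l / 2 - x)).
  by apply: L2on_reflection (v2 None); rewrite /= ?subrr ?subr0.
have i1 := L2on_mul (L2on_scale s r1) (v2 None).
rewrite -(Rint_reflection (c := l / 2) (esym (subrr _)) (esym (subr0 _)) i1).
rewrite -RintD; last 2 first.
- by apply: integrable_on_reflection i1; rewrite ?subrr ?subr0.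
- exact: L2on_mul.
apply: eq_Rint => x _; rewrite subKr /fold_avg /pair_avg.
by field.
Qed.

Lemma cut_avg_lin s (a : R) f g :
  cut_avg s (fun i x => a * f i x + g i x) = (fun j x => a * cut_avg s f j x + cut_avg s g j x).
Proof.
apply/funext => -[i|]; apply/funext => x /=; last by rewrite /fold_avg; ring.
by case: ifP => // _; rewrite /fold_avg; ring.
Qed.

Lemma cut_avg_integrable f j : (forall i, integrable_on 0 (len G i) (f i)) ->
  integrable_on 0 (len G' j) (cut_avg 1 f j).
Proof.
move=> fi.
have r1 : integrable_on 0 l (fun x => f e0 (l - x)).
  by apply: integrable_on_reflection (fi e0); rewrite ?subrr ?subr0.
have s1 : integrable_on 0 l (fold_avg 1 f).
  apply: integrable_on_eq (integrable_onZ 2^-1 (integrable_onD (fi e0) r1)) => x _.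
  by rewrite /fold_avg mul1r.
have s2 : integrable_on 0 (l / 2) (fold_avg 1 f) by exact: integrable_on_sub s1.
case: j => [i|]; last first.
  have : integrable_on 0 (l / 2) (fun x => fold_avg 1 f (l / 2 - x)).
    by apply: integrable_on_reflection s2; rewrite ?subrr ?subr0.
  by apply: integrable_on_eq => x _; rewrite /= mul1r.
by rewrite len_cut /cut_avg; case: eqP => [_|_]; [exact: s2|exact: fi].
Qed.

(** By convexity the square of an average is at most the average of the squares,
    and averaging preserves integrals. *)
Lemma cut_avg_norm f : @L2 _ G f ->
  nrm (graph_space G') (cut_avg 1 f) <= nrm (graph_space G) f.
Proof.
move=> f2; rewrite ler_wsqrtr//.
have ff i : integrable_on 0 (len G i) (fun x => f i x * f i x) by exact: (L2on_mul (f2 i) (f2 i)).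
have af2 := cut_avg_L2 1 f2.
apply: (@le_trans _ _ (@graph_int _ G' (cut_avg 1 (fun i x => f i x * f i x)))); last first.
  by rewrite graph_int_cut_avg.
apply: ler_sum => j _; apply: le_Rintegral.
- exact: measurable_itv.
- exact: (L2on_mul (af2 j) (af2 j)).
- exact: cut_avg_integrable.
- have sq (a b : R) : 2^-1 * (a + 1 * b) * (2^-1 * (a + 1 * b)) <=
      2^-1 * (a * a + 1 * (b * b)).
    rewrite -subr_ge0.
    have -> : 2^-1 * (a * a + 1 * (b * b)) - 2^-1 * (a + 1 * b) * (2^-1 * (a + 1 * b)) =
      (2^-1 * (a - b)) ^+ 2 by field.
    exact: sqr_ge0.
  case: j => [i|] x _ /=; last by rewrite !mul1r; exact: sq.
  by case: ifP => // _; exact: sq.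
Qed.

Lemma fold_avg_primitive u w : integrable_on 0 l (w e0) -> primitive l (u e0) (w e0) ->
  primitive l (fold_avg 1 u) (fold_avg (-1) w).
Proof.
move=> wi uw.
have wr : integrable_on 0 l (fun x => - w e0 (l - x)).
  by apply: integrable_onN; apply: integrable_on_reflection wi; rewrite ?subrr ?subr0.
have := primitive_lin 1 wr wi (primitive_reflection wi uw) uw.
move=> /(primitive_scale 2^-1 (integrable_onD (integrable_onZ 1 wr) wi)).
by apply: primitive_eq => x; rewrite /fold_avg; ring.
Qed.

Lemma cut_avg_H1 u w : H1 u w -> @H1 _ G' (cut_avg 1 u) (cut_avg (-1) w).
Proof.
move=> [w2 uw]; split; first exact: cut_avg_L2.
have wi i : integrable_on 0 (len G i) (w i) by exact: (L2on_int (w2 i)).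
have p1 := fold_avg_primitive (wi e0) (uw e0).
have pi : integrable_on 0 (l / 2) (fold_avg (-1) w).
  by apply: integrable_on_sub (L2on_int (fold_avg_L2 (-1) w2)).
have p2 := primitive_sub hl p1.
move=> [i|]; last first.
  by apply: primitive_eq (primitive_reflection pi p2) => x /=; ring.
rewrite -/(primitive (len G' (Some i)) (cut_avg 1 u (Some i)) (cut_avg (-1) w (Some i))).
by rewrite len_cut /cut_avg; case: eqP => [_|_]; [exact: p2|exact: uw].
Qed.

Lemma unfold_avg_H1 v z : @H1 _ G' v z -> H1 (unfold_avg 1 v) (unfold_avg (-1) z).
Proof.
move=> [z2 vz]; split; first exact: unfold_avg_L2.
move=> i; rewrite -/(primitive (len G i) (unfold_avg 1 v i) (unfold_avg (-1) z i)) /unfold_avg.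
case: eqP => [->|/eqP ie]; last first.
  by have := vz (Some i); rewrite /edge_itv len_cut (negbTE ie).
apply: primitive_mirror_ext; [exact: ltW|exact: pair_avg_L2|].
have zN : integrable_on 0 (l / 2) (z None) by exact: (L2on_int (z2 None)).
have zS : integrable_on 0 (l / 2) (z (Some e0)).
  by rewrite -len_cut0; exact: (L2on_int (z2 (Some e0))).
have vS : primitive (l / 2) (v (Some e0)) (z (Some e0)).
  by rewrite -len_cut0; exact: (vz (Some e0)).
have vN : primitive (l / 2) (v None) (z None) by exact: (vz None).
have zr : integrable_on 0 (l / 2) (fun x => - z None (l / 2 - x)).
  by apply: integrable_onN; apply: integrable_on_reflection zN; rewrite ?subrr ?subr0.
have := primitive_lin 1 zr zS (primitive_reflection zN vN) vS.
move=> /(primitive_scale 2^-1 (integrable_onD (integrable_onZ 1 zr) zS)).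
by apply: primitive_eq => x; rewrite /pair_avg; ring.
Qed.

Hypothesis loop : ends G e0 false = ends G e0 true.

Lemma fold_avg0 u : u e0 l = u e0 0 -> fold_avg 1 u 0 = u e0 0.
Proof. by rewrite /fold_avg subr0 => ->; field. Qed.

(** The loop takes the same value at both ends, so averaging does not change
    it. *)
Lemma cut_avg_endpoint u j c x : u e0 l = u e0 0 -> ends G' j c = inl x ->
  exists i b, ends G i b = x /\
    cut_avg 1 u j (edge_point j c) = u i (edge_point i b).
Proof.
move=> ul; case: j => [i|] /=; last first.
  case: c => //= -[<-]; exists e0, true; split => //=.
  by rewrite subrr mul1r fold_avg0.
case: (eqVneq i e0) => [->|ie] /=.
  by case: c => //= -[<-]; exists e0, false; split => //=; rewrite fold_avg0.
by move=> [<-]; exists i, c; split => //; rewrite /edge_point len_cut (negbTE ie).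
Qed.

(** Each new vertex carries a single edge end and so imposes no continuity
    condition. *)
Lemma new_vertex_end j c b : ends G' j c = inr b ->
  (j, c) = if b then (None, false) else (Some e0, true).
Proof.
case: j => [i|] /=; last by case: c => //= -[<-].
by case: eqVneq => [->|_] //=; case: c => //= -[<-].
Qed.

Lemma cut_avg_H10 D u w : H10 D u w ->
  @H10 _ G' (cut_dirichlet e0 D) (cut_avg 1 u) (cut_avg (-1) w).
Proof.
move=> [uw ucont uD]; have ul : u e0 l = u e0 0.
  by have := ucont e0 true e0 false (esym loop).
split; first exact: cut_avg_H1.
- move=> j c j' c'; case E: (ends G' j c) => [x|b] E'.
    have [i [b [ib ->]]] := cut_avg_endpoint ul E.
    have [i' [b' [ib' ->]]] := cut_avg_endpoint ul (esym E').
    by apply: ucont; rewrite ib ib'.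
  have := new_vertex_end (esym E'); rewrite -(new_vertex_end E).
  by move=> [-> ->].
- move=> j c /imsetP[x xD E].
  have [i [b [ib ->]]] := cut_avg_endpoint ul E.
  by apply: uD; rewrite ib.
Qed.

(** The loop is at 0 and at l the average of the values that v takes at the
    outer ends of the two pendant edges; these ends lie at one vertex, so
    averaging does not change the value. *)
Lemma unfold_avg_endpoint v i b :
  (forall j c j' c', ends G' j c = ends G' j' c' ->
     v j (edge_point j c) = v j' (edge_point j' c')) ->
  exists j c, ends G' j c = inl (ends G i b) /\
    unfold_avg 1 v i (edge_point i b) = v j (edge_point j c).
Proof.
move=> vcont; rewrite /unfold_avg; case: (eqVneq i e0) => [->|ie].
  exists (Some e0), false; split; first by rewrite /= andbF; case: b; rewrite ?loop.
  have vN : v None (l / 2) = v (Some e0) 0.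
    by apply: (vcont None true (Some e0) false); rewrite /= eqxx/= loop.
  have r0 : pair_avg 1 v 0 = v (Some e0) 0.
    by rewrite /pair_avg subr0 vN; field.
  rewrite /mirror_ext; case: b => /=; last by rewrite h0.
  by rewrite subrr r0 mul1r; case: ifP => // H; exfalso; move: H l0; lra.
exists (Some i), b; split; first by rewrite /= (negbTE ie).
by rewrite /edge_point len_cut (negbTE ie).
Qed.

Lemma unfold_avg_H10 D v z : @H10 _ G' (cut_dirichlet e0 D) v z ->
  H10 D (unfold_avg 1 v) (unfold_avg (-1) z).
Proof.
move=> [vz vcont vD]; split; first exact: unfold_avg_H1.
- move=> i b i' b' E.
  have [j [c [jc ->]]] := unfold_avg_endpoint i b vcont.
  have [j' [c' [jc' ->]]] := unfold_avg_endpoint i' b' vcont.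
  by apply: vcont; rewrite jc jc' E.
- move=> i b ibD; have [j [c [jc ->]]] := unfold_avg_endpoint i b vcont.
  by apply: vD; rewrite jc; apply/imsetP; exists (ends G i b).
Qed.

Lemma fold_avg_ae s f g :
  {ae mu, forall x, edge_itv e0 x -> f e0 x = g e0 x} ->
  {ae mu, forall x, `[0, l]%classic x -> fold_avg s f x = fold_avg s g x}.
Proof.
move=> fg.
have fgr := ae_reflection (esym (subrr l)) (esym (subr0 l)) fg.
case: fg => N [mN N0 sN]; case: fgr => M [mM M0 sM].
exists (N `|` M); split; [exact: measurableU|by rewrite measureU0|].
move=> x /= nh; have [Nx|Nx] := pselect (N x); first by left.
right; apply: sM => /= H2; apply: nh => xl.
have H1' : f e0 x = g e0 x.
  by apply: contrapT => H; apply: Nx; apply: sN => /= K; apply: H; exact: K.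
by rewrite /fold_avg H1' (H2 xl).
Qed.

Lemma cut_avg_L2eq s f g : L2eq f g -> @L2eq _ G' (cut_avg s f) (cut_avg s g).
Proof.
move=> fg.
have hae : {ae mu, forall x, `[0, l / 2]%classic x -> fold_avg s f x = fold_avg s g x}.
  apply: ae_imp (fold_avg_ae s (fg e0)) => x H; rewrite /= in_itv/= => /andP[x0 xl].
  by apply: H; rewrite /= in_itv/= x0 (le_trans xl).
move=> [i|].
  rewrite /edge_itv len_cut /cut_avg; case: eqP => [_|_]; first exact: hae.
  exact: fg.
apply: ae_imp (ae_reflection (esym (subrr _)) (esym (subr0 _)) hae) => x H xl /=.
by rewrite H.
Qed.

(** Write S, S* for the operators with s = 1 and P, P* for those with s = -1. If
    u has the derivative w and the test function v the derivative z, then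
    <(S u)', z> = <P w, z> = <w, P* z> = <w, (S* v)'>, and the weak equation for
    u applies with the test function S* v. *)
Lemma cut_avg_laplacian D f g : laplacian D f g ->
  @laplacian _ G' (cut_dirichlet e0 D) (cut_avg 1 f) (cut_avg 1 g).
Proof.
move=> [f2 g2 [u [w [uf uD Huw]]]].
split; [exact: cut_avg_L2|exact: cut_avg_L2|].
exists (cut_avg 1 u), (cut_avg (-1) w); split; [exact: cut_avg_L2eq|exact: cut_avg_H10|].
move=> v z vD.
have [[w2 _] _ _] := uD; have [[z2 vz] _ _] := vD.
have v2 : @L2 _ G' v by move=> j; exact: (primitive_L2on (z2 j) (vz j)).
rewrite cut_avg_adjoint// (Huw _ _ (unfold_avg_H10 vD)).
have gN : @L2 _ G (fun i x => - g i x).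
  by move=> i; apply: L2on_eq (L2on_scale (-1) (g2 i)) => x _; rewrite mulN1r.
rewrite -cut_avg_adjoint//; apply: eq_bigr => j _; apply: eq_Rint => x _.
by congr (_ * _); case: j => [i|] /=; [case: ifP => // _|]; rewrite /fold_avg; ring.
Qed.

End Averaging.

(** * Invariance of the heat content *)

Theorem proposition6p4 (R : realType) (G : metric_graph R)
    (D : {set vertex G}) (e : edge G)
    (p : R -> graph_kernel G) (p' : R -> graph_kernel (midpoint_cut e)) :
  standing_assumption D -> is_loop e ->
  heat_kernel D p -> heat_kernel (cut_dirichlet e D) p' ->
  forall t : R, 0 < t -> heat_content p t = heat_content p' t.
Proof.
move=> _ /eqP loop [T [[sT gT] kT]] [T' [[sT' gT'] kT']] t t0.
have T_L2 f : L2 f -> L2 (T t f).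
  by case: sT => H _ _ _; have [h _ _] := H t (ltW t0); exact: h.
have T'_L2 f : L2 f -> L2 (T' t f).
  by case: sT' => H _ _ _; have [h _ _] := H t (ltW t0); exact: h.
rewrite /heat_content (kernel_graph_int (kT t t0) T_L2) (kernel_graph_int (kT' t t0) T'_L2).
have one : @L2 _ G (fun _ _ => 1) by exact: L2_cst.
have one' : @L2 _ (midpoint_cut e) (fun _ _ => 1) by exact: L2_cst.
have cut_avg1 : cut_avg (e0 := e) 1 (fun _ _ => 1) = (fun _ _ => 1).
  apply/funext => -[i|]; apply/funext => x /=; last by rewrite /fold_avg; field.
  by case: ifP => // _; rewrite /fold_avg; field.
have T1i i : integrable_on 0 (len G i) (T t (fun _ _ => 1) i) by exact: (L2on_int (T_L2 _ one i)).
rewrite -(graph_int_cut_avg e T1i).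
apply: graph_int_eqv; [exact/cut_avg_L2/T_L2|exact: T'_L2|].
rewrite -[in T' t _]cut_avg1.
have cut_avg_bound (f : edge G -> R -> R^o) : dom (graph_space G) f ->
    nrm (graph_space (midpoint_cut e)) (cut_avg (e0 := e) 1 f) <= 1 * nrm (graph_space G) f.
  by move=> f2; rewrite mul1r; exact: cut_avg_norm.
apply: (@intertwined_closure _ _ _ _ _ _ _ (cut_avg (e0 := e) 1)
  (C0_semigroup_abstract sT) (C0_semigroup_abstract sT') _ _ 1) => //.
- by move=> f; exact: cut_avg_L2.
- by move=> a f g; exact: cut_avg_lin.
- by move=> f g /gT /(cut_avg_laplacian loop) /gT'.
- by move=> f g /gT'; exact: laplacian_dissipative.
- exact: ltW.
- move=> eps eps0; have [h [g [hg H]]] := laplacian_dense_at_one D eps0.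
  by exists h, g; split => //; apply/gT.
Qed.
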